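(* Let $\varphi\in L^1_{\rm loc}([0,\infty))$ with $\sup_{x\ge0}\int_x^{x+1}|\varphi|<\infty$, let $\lambda\in\mathbb R$, and let $c_\pm=3\pm\sqrt8$. For $\xi\in\partial\mathbb D$ and $L>0$ define $\epsilon=\epsilon(\xi,L)>0$ by $\|A+\xi B\|_L\,\|A-\xi B\|_L=\frac1{2\epsilon}$. Then $$c_-\frac{\|A-\xi B\|_L}{\|A+\xi B\|_L}\le\left|\frac{1+\xi s(\lambda+i\epsilon(\xi,L))}{1-\xi s(\lambda+i\epsilon(\xi,L))}\right|\le c_+\frac{\|A-\xi B\|_L}{\|A+\xi B\|_L}.$$ In particular, $\lim_{\epsilon\downarrow0}s(\lambda+i\epsilon)=\overline\xi$ if and only if the solution $W$ of $\Lambda_\varphi W=\lambda W$ with $W(0)=(1,\xi)^\top$ is subordinate at $+\infty$.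
   Context: $\Lambda_\varphi=\begin{bmatrix} i&0\\0&-i\end{bmatrix}\frac{d}{dx}+\begin{bmatrix}0&\varphi\\ \overline{\varphi}&0\end{bmatrix}$ on $[0,\infty)$. For $\Im z>0$, the Weyl solution $\Psi(z,\cdot)$ is the (unique up to scalar) solution of $\Lambda_\varphi\Psi=z\Psi$ in $L^2([0,\infty),\mathbb C^2)$, normalized $\Psi(z,0)=(s(z),1)^\top$; $s$ is the Schur function. $T(\lambda,x)$ is the solution of $\Lambda_\varphi T=\lambda T$, $T(\lambda,0)=I$; for real $\lambda$ it lies in $SU(1,1)$ and is written $T(\lambda,x)=\begin{bmatrix}A(\lambda,x)&B(\lambda,x)\\ \overline{B(\lambda,x)}&\overline{A(\lambda,x)}\end{bmatrix}$. $\|f\|_L=(\int_0^L|f|^2)^{1/2}$. A solution $V$ of $\Lambda_\varphi V=\lambda V$ is subordinate at $+\infty$ if $\|U\|_L/\|V\|_L\to\infty$ as $L\to\infty$ for every solution $U$ linearly independent of $V$. *)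

(* Defs.v *)
From HB Require Import structures.
From mathcomp Require Import all_boot all_order all_algebra.
From mathcomp Require Import all_classical all_reals all_analysis.
From mathcomp Require Import complex.
Set Implicit Arguments. Unset Strict Implicit. Unset Printing Implicit Defensive.
Import Order.TTheory GRing.Theory Num.Theory.
Import numFieldNormedType.Exports.
Local Open Scope classical_set_scope.
Local Open Scope ring_scope.

Definition cabs2 {R : realType} (z : R[i]) : R := complex.Re z ^+ 2 + complex.Im z ^+ 2.
Definition cabs {R : realType} (z : R[i]) : R := Num.sqrt (cabs2 z).

Definition cintegrable {R : realType} (A : set R) (f : R -> R[i]) : Prop :=
  (@lebesgue_measure R).-integrable A (EFin \o (fun x => complex.Re (f x))) /\
  (@lebesgue_measure R).-integrable A (EFin \o (fun x => complex.Im (f x))).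

Definition cint {R : realType} (A : set R) (f : R -> R[i]) : R[i] :=
  Complex (Rintegral (@lebesgue_measure R) A (fun x => complex.Re (f x)))
          (Rintegral (@lebesgue_measure R) A (fun x => complex.Im (f x))).

Definition unif_loc_L1 {R : realType} (phi : R -> R[i]) : Prop :=
  (forall L : R, 0 <= L -> cintegrable `[0, L] phi) /\
  exists M : R, forall x : R, 0 <= x ->
    (\int[@lebesgue_measure R]_(t in `[x, (x + 1)%R]) (cabs (phi t))%:E <= M%:E)%E.

Local Open Scope complex_scope.
Definition dirac_rhs1 {R : realType} (phi : R -> R[i]) (z : R[i])
  (V : R -> R[i] * R[i]) : R -> R[i] :=
  fun t => - 'i * z * (V t).1 + 'i * phi t * (V t).2.
Definition dirac_rhs2 {R : realType} (phi : R -> R[i]) (z : R[i])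
  (V : R -> R[i] * R[i]) : R -> R[i] :=
  fun t => 'i * z * (V t).2 - 'i * (phi t)^* * (V t).1.
Local Close Scope complex_scope.

Definition is_sol {R : realType} (phi : R -> R[i]) (z : R[i])
  (V : R -> R[i] * R[i]) : Prop :=
  forall x : R, 0 <= x ->
    [/\ cintegrable `[0, x] (dirac_rhs1 phi z V),
        cintegrable `[0, x] (dirac_rhs2 phi z V),
        (V x).1 = (V 0).1 + cint `[0, x] (dirac_rhs1 phi z V) &
        (V x).2 = (V 0).2 + cint `[0, x] (dirac_rhs2 phi z V)].

Definition in_L2 {R : realType} (V : R -> R[i] * R[i]) : Prop :=
  (\int[@lebesgue_measure R]_(t in `[0%R, +oo[%classic) (cabs2 (V t).1 + cabs2 (V t).2)%:E < +oo)%E.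

Definition is_schur {R : realType} (phi : R -> R[i]) (s : R[i] -> R[i]) : Prop :=
  forall z : R[i], 0 < complex.Im z ->
    exists Psi : R -> R[i] * R[i],
      [/\ is_sol phi z Psi, Psi 0 = (s z, 1) & in_L2 Psi].

Definition normL {R : realType} (L : R) (f : R -> R[i]) : R :=
  Num.sqrt (Rintegral (@lebesgue_measure R) `[0, L] (fun t => cabs2 (f t))).

Definition normL2 {R : realType} (L : R) (V : R -> R[i] * R[i]) : R :=
  Num.sqrt (Rintegral (@lebesgue_measure R) `[0, L]
                      (fun t => cabs2 (V t).1 + cabs2 (V t).2)).

Definition lin_indep {R : realType} (U V : R -> R[i] * R[i]) : Prop :=
  forall a b : R[i],
    (forall x : R, 0 <= x ->
       a * (U x).1 + b * (V x).1 = 0 /\ a * (U x).2 + b * (V x).2 = 0) ->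
    a = 0 /\ b = 0.

Definition subordinate {R : realType} (phi : R -> R[i]) (z : R[i])
  (V : R -> R[i] * R[i]) : Prop :=
  forall U : R -> R[i] * R[i], is_sol phi z U -> lin_indep U V ->
    (fun L : R => normL2 L U / normL2 L V) @ +oo --> +oo.

Definition lim_from_above {R : realType} (s : R[i] -> R[i]) (lam : R) (w : R[i]) : Prop :=
  (fun e : R => cabs (s (Complex lam e) - w)) @ 0^'+ --> 0.

(* Main.v *)
(* Every solution at lam + i e is expanded in the two solutions at lam with initial data
   (1, xi) and (1, -xi), i.e. (f, xi f^-) and (g, -xi g^-) with f = A + xi B, g = A - xi B.
   The coefficients solve a canonical system at spectral parameter i e whose Hamiltonian
   has entries |f|^2, |g|^2, Im(f g^-) and determinant Re(f g^-)^2 = 1.  When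
   2 e ||f||_L ||g||_L = 1 its solution operator on [0, L] differs from the identity by a
   Volterra operator of Hilbert-Schmidt norm at most 1/2, so the energy on [0, L] of the
   constant initial vector (a, b) is at most 9/4 that of the Weyl solution, which is at most
   (1 - |s|^2) / (4 e) = - Re(a b^-) / e.  For t = |a| ||f||_L / (|b| ||g||_L) this yields
   t^2 - 6 t + 1 <= 0, and |a / b| is the quotient to be estimated. *)
Require Import Defs.
From HB Require Import structures.
From mathcomp Require Import all_boot all_order all_algebra.
From mathcomp Require Import all_classical all_reals all_analysis.
From mathcomp Require Import complex.
From mathcomp Require Import measurable_realfun ring lra.
Import Order.TTheory GRing.Theory Num.Theory.
Import numFieldNormedType.Exports.
Set Implicit Arguments. Unset Strict Implicit. Unset Printing Implicit Defensive.
Local Open Scope classical_set_scope.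
Local Open Scope ring_scope.

(** * Absolutely continuous functions on [0, oo) *)

(** Since [phi] is only locally integrable, solutions need not have pointwise derivatives; all
    calculus is done with a function and an integrable density. The coefficients are Wronskians of
    the Weyl solution with solutions at the real point: [phi] and [lam] cancel from their densities,
    only the factor e survives, and [phi] enters through f and g alone. The squared Hilbert-Schmidt
    norm is e^2 det(int H), because tr(adj H int H) is the derivative of that determinant; this is
    why the normalisation of e involves the product of the two norms. For the final equivalence,
    both sides are compared with ||g||_L / ||f||_L -> oo. Since Re(f g^-) = 1, one has ||f||_L
    ||g||_L >= L, so e tends to 0 as L grows; by continuity in L it takes every small positive
    value, and the two-sided bound controls the full limit, not just a sequence. *)

Section Calculus.
Variable R : realType.
Notation mu := (@lebesgue_measure R).
Implicit Types (f g u v du dv : R -> R) (x y t : R).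

Definition cont0 f := forall x, 0 <= x -> {within `[0, x], continuous f}.
Definition int0 f x := Rintegral mu `[0, x] f.
Definition Lint f := forall x, 0 <= x -> mu.-integrable `[0, x] (EFin \o f).
(** Absolute continuity in integral form: [du] is one chosen density of [u], which matches the
    integral form of [is_sol]. *)
Definition primitive u du := Lint du /\ forall x, 0 <= x -> u x = u 0 + int0 du x.

Lemma cont0_cst c : cont0 (fun=> c).
Proof. by move=> x _ t; exact: cvg_cst. Qed.

Lemma cont0D f g : cont0 f -> cont0 g -> cont0 (fun t => f t + g t).
Proof. by move=> cf cg x x0 t; apply: cvgD; [exact: cf|exact: cg]. Qed.

Lemma cont0M f g : cont0 f -> cont0 g -> cont0 (fun t => f t * g t).
Proof. by move=> cf cg x x0 t; apply: cvgM; [exact: cf|exact: cg]. Qed.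

Lemma cont0N f : cont0 f -> cont0 (fun t => - f t).
Proof. by move=> cf x x0 t; apply: cvgN; exact: cf. Qed.

Lemma cont0B f g : cont0 f -> cont0 g -> cont0 (fun t => f t - g t).
Proof. by move=> cf cg; apply: cont0D => //; exact: cont0N. Qed.

Lemma cont0X f n : cont0 f -> cont0 (fun t => f t ^+ n).
Proof.
move=> cf; elim: n => [|n IH].
  by rewrite (_ : (fun _ => _) = fun=> 1); [exact: cont0_cst|apply/funext => t; rewrite expr0].
by rewrite (_ : (fun _ => _) = fun t => f t * f t ^+ n);
  [exact: cont0M|apply/funext => t; rewrite exprS].
Qed.

Lemma cont0P f : cont0 f <-> forall X x e, 0 <= x <= X -> 0 < e ->
  exists2 d, 0 < d & forall y, 0 <= y <= X -> `|y - x| < d -> `|f y - f x| < e.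
Proof.
split=> [cf X x e xX e0|H X X0].

- have X0 : 0 <= X by case/andP: xX => x0; exact: le_trans.
  have /subspace_continuousP/(_ x) := cf _ X0.
  rewrite /= in_itv/= => /(_ xX)/cvgrPdist_lt/(_ _ e0).
  rewrite near_withinE => -[d /= d0 Hd]; exists d => // y yX yx.
  by rewrite distrC; apply: Hd; rewrite /= ?in_itv//= distrC.
- apply/subspace_continuousP => x /=; rewrite in_itv/= => xX.
  apply/cvgrPdist_lt => e e0; have [d d0 Hd] := H X x e xX e0.
  rewrite near_withinE; exists d => //= y yx.
  by rewrite in_itv/= => yX; rewrite distrC; apply: Hd => //; rewrite distrC.
Qed.

Lemma eq_cont0 f g : (forall x, 0 <= x -> f x = g x) -> cont0 f -> cont0 g.
Proof.
move=> fg /cont0P cf; apply/cont0P => X x e xX e0.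
have [d d0 Hd] := cf X x e xX e0; exists d => // y yX yx.
by rewrite -!fg ?Hd//; [case/andP: xX|case/andP: yX].
Qed.

Lemma cont0_Lint f : cont0 f -> Lint f.
Proof.
by move=> cf x x0; apply: continuous_compact_integrable; [exact: segment_compact|exact: cf].
Qed.

Lemma eq_Lint f g : (forall x, 0 <= x -> f x = g x) -> Lint f -> Lint g.
Proof.
move=> fg If x x0; apply: eq_integrable (If x x0) => //= t.
by rewrite inE/= in_itv/= => /andP[t0 _]; rewrite fg.
Qed.

Lemma LintD f g : Lint f -> Lint g -> Lint (fun t => f t + g t).
Proof.
move=> If Ig x x0; rewrite (_ : _ \o _ = (EFin \o f) \+ (EFin \o g))%E//.
by apply: integrableD => //; [exact: If|exact: Ig].
Qed.

Lemma LintM f g : Lint f -> cont0 g -> Lint (fun t => f t * g t).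
Proof.
move=> If cg x x0; rewrite (_ : _ \o _ = (EFin \o f) \* (EFin \o g))%E//.
apply: integrableMl => //; first exact: If.
  by apply: subspace_continuous_measurable_fun => //; exact: cg.
have /compact_bounded[M [_ HM]] := continuous_compact (cg _ x0) (@segment_compact _ 0 x).
by exists M; split; rewrite ?num_real // => ? ? ? ?; exact: HM.
Qed.

Lemma LintZ c f : Lint f -> Lint (fun t => c * f t).
Proof.
move=> If; apply: (@eq_Lint (fun t => f t * c)) => [x _|]; first by rewrite mulrC.
by apply: LintM => //; exact: cont0_cst.
Qed.

Lemma Lint_norm f : Lint f -> Lint (fun t => `|f t|).
Proof.
move=> If x x0; rewrite (_ : _ \o _ = abse \o (EFin \o f))//.
by apply: integrable_abse; exact: If.
Qed.

Lemma eq_int0 f g x : (forall t, 0 <= t -> f t = g t) -> int0 f x = int0 g x.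
Proof.
move=> fg; apply: eq_Rintegral => t; rewrite inE/= in_itv/= => /andP[t0 _].
exact: fg.
Qed.

Lemma int0D f g x : Lint f -> Lint g -> 0 <= x ->
  int0 (fun t => f t + g t) x = int0 f x + int0 g x.
Proof. by move=> If Ig x0; apply: RintegralD => //; [exact: If|exact: Ig]. Qed.

Lemma int0Z c f x : Lint f -> 0 <= x -> int0 (fun t => c * f t) x = c * int0 f x.
Proof. by move=> If x0; apply: RintegralZl => //; exact: If. Qed.

Lemma le_int0 f g x : Lint f -> Lint g -> 0 <= x ->
  (forall t, 0 <= t <= x -> f t <= g t) -> int0 f x <= int0 g x.
Proof.
move=> If Ig x0 fg; apply: le_Rintegral => //.
  exact: If.
exact: Ig.
Qed.

Lemma int0_cst c x : 0 <= x -> int0 (fun=> c) x = c * x.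
Proof.
move=> x0; rewrite /int0 Rintegral_cst//= [mu _](lebesgue_measure_itv `[0, x])/= lte_fin.
case: ltP => /= [_|x_le0]; first by rewrite subr0.
by congr (_ * _); apply/le_anti; rewrite x0.
Qed.

Lemma int0_at0 f : int0 f 0 = 0.
Proof. by rewrite /int0 set_itv1 Rintegral_set1. Qed.

Lemma int0_ge0 f x : (forall t, 0 <= t -> 0 <= f t) -> 0 <= int0 f x.
Proof. by move=> f0; apply: Rintegral_ge0 => t /=; rewrite in_itv/= => /andP[/f0]. Qed.

Lemma int0_cont f : Lint f -> cont0 (int0 f).
Proof. by move=> If x x0; apply: parameterized_integral_continuous => //; exact: If. Qed.

Lemma prim_int0 f : Lint f -> primitive (int0 f) f.
Proof. by move=> If; split => // x x0; rewrite int0_at0 add0r. Qed.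

Lemma prim_cont u du : primitive u du -> cont0 u.
Proof.
move=> [Idu uE]; apply: (@eq_cont0 (fun x => u 0 + int0 du x)).
  by move=> x x0; rewrite [RHS]uE.
by apply: cont0D; [exact: cont0_cst|exact: int0_cont].
Qed.

Lemma eq_prim u v du dv : (forall x, 0 <= x -> u x = v x) ->
  (forall x, 0 <= x -> du x = dv x) -> primitive u du -> primitive v dv.
Proof.
move=> uv duv [Idu uE]; split; first exact: eq_Lint Idu.
by move=> x x0; rewrite -!uv// uE//; congr (_ + _); exact: eq_int0.
Qed.

Lemma prim_cst c : primitive (fun=> c) (fun=> 0).
Proof.
split; first exact/cont0_Lint/cont0_cst.
by move=> x x0; rewrite int0_cst// mul0r addr0.
Qed.

Lemma primD u v du dv : primitive u du -> primitive v dv ->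
  primitive (fun t => u t + v t) (fun t => du t + dv t).
Proof.
move=> [Idu uE] [Idv vE]; split; first exact: LintD.
by move=> x x0; rewrite int0D// uE// vE//; ring.
Qed.

Lemma primZ c u du : primitive u du -> primitive (fun t => c * u t) (fun t => c * du t).
Proof.
move=> [Idu uE]; split; first exact: LintZ.
by move=> x x0; rewrite int0Z// uE//; ring.
Qed.

Lemma primN u du : primitive u du -> primitive (fun t => - u t) (fun t => - du t).
Proof.
by move/(primZ (-1)); apply: eq_prim => x _; rewrite mulN1r.
Qed.

Lemma primB u v du dv : primitive u du -> primitive v dv ->
  primitive (fun t => u t - v t) (fun t => du t - dv t).
Proof. by move=> hu hv; apply: primD hu _; exact: primN. Qed.

Lemma prim_mono u du x y : primitive u du -> 0 <= x <= y ->
  (forall t, x <= t <= y -> 0 <= du t) -> u x <= u y.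
Proof.
move=> [Idu uE] /andP[x0 xy] du0; have y0 := le_trans x0 xy.
rewrite uE// (uE y)// lerD2l -subr_ge0 /int0.
rewrite Rintegral_itvB//; [|exact: Idu].
apply: Rintegral_ge0 => t /=; rewrite in_itv/= => /andP[xt ty].
by apply: du0; rewrite (ltW xt).
Qed.

Lemma prim_le u v du dv x y : primitive u du -> primitive v dv -> 0 <= x <= y ->
  (forall t, x <= t <= y -> du t <= dv t) -> u y - u x <= v y - v x.
Proof.
move=> hu hv xy duv.
have := prim_mono (primB hv hu) xy; rewrite lerBlDr => H.
rewrite -subr_ge0; have {}H : v x - u x <= v y - u y.
  by rewrite lerBlDr; apply: H => t /duv; rewrite subr_ge0.
lra.
Qed.

(** Let m be the supremum of the points up to which Q holds throughout. The last hypothesis gives Q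
    at m, and the middle one would push past m if m < X. *)
Lemma real_induction (Q : R -> Prop) X :
  Q 0 ->
  (forall x, 0 <= x < X -> (forall y, 0 <= y <= x -> Q y) ->
     exists2 d, 0 < d & forall y, x <= y < x + d -> y <= X -> Q y) ->
  (forall x, 0 < x <= X -> (forall y, 0 <= y < x -> Q y) -> Q x) ->
  forall x, 0 <= x <= X -> Q x.
Proof.
move=> Q0 Qr Ql.
move=> x0 /andP[x00 x0X]; have X0 : 0 <= X by exact: le_trans x0X.
pose S := [set x | 0 <= x <= X /\ forall y, 0 <= y <= x -> Q y].
have S0 : S 0.
  by split; rewrite ?lexx//= => y /le_anti <-.
have hS : has_sup S by split; [exists 0|exists X => y [/andP[]]].
pose m := sup S.
have m0 : 0 <= m by apply: ub_le_sup => //; case: hS.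
have mX : m <= X by apply: ge_sup; [case: hS|move=> y [/andP[]]].
have Sm : S m.
  have lt y : 0 <= y < m -> Q y.
    move=> /andP[y0 ym]; have [z Sz yz] := sup_gt (proj1 hS) ym.
    by case: Sz => _; apply; rewrite y0 ltW.
  split; first by rewrite m0.
  move=> y /andP[y0]; rewrite le_eqVlt => /orP[/eqP->|ym]; last by apply: lt; rewrite y0.
  move: m0; rewrite le_eqVlt => /orP[/eqP<-//|m0]; apply: Ql => //.
  by rewrite m0.
have mE : m = X.
  apply/eqP; rewrite eq_le mX/= leNgt; apply/negP => mltX.
  have [|d d0 Hd] := Qr m _ (proj2 Sm); first by rewrite m0.
  pose y := Num.min X (m + d / 2).
  have my : m < y by rewrite /y lt_min mltX/=; lra.
  have yX : y <= X by rewrite /y ge_min lexx.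
  have yd : y < m + d by rewrite /y gt_min; apply/orP; right; lra.
  suff : S y by move=> /(ub_le_sup (proj2 hS)); rewrite leNgt my.
  split; first by rewrite yX andbT; exact: le_trans (ltW my).
  move=> z /andP[z0 zy]; have [zm|mz] := leP z m; first by apply: (proj2 Sm); rewrite z0.
  by apply: Hd; [rewrite (ltW mz) (le_lt_trans zy)|exact: le_trans yX].
by apply: (proj2 Sm); rewrite x00 mE.
Qed.

Lemma cont0_ge0_left f x : cont0 f -> 0 < x -> (forall y, 0 <= y < x -> 0 <= f y) ->
  0 <= f x.
Proof.
move=> /cont0P cf x0 fy; rewrite leNgt; apply/negP => fx.
have [||d d0 Hd] := cf x x (- f x); [by rewrite (ltW x0) lexx|by rewrite oppr_gt0|].
pose y := Num.max 0 (x - d / 2).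
have y0 : 0 <= y by rewrite le_max lexx.
have yx : y < x by rewrite gt_max x0/=; lra.
have yd : x - d / 2 <= y by rewrite le_max lexx orbT.
have /Hd : 0 <= y <= x by rewrite y0 ltW.
have -> : `|y - x| < d by rewrite ltr_norml; apply/andP; split; lra.
have := fy y; rewrite y0 yx => /(_ isT) fy0 /(_ isT).
by rewrite ltr_norml => /andP[_]; lra.
Qed.

(* On a short interval [x, y] the defect of the product rule is at most the oscillation of
   u and v times the increment of int (|du| + |dv|); real induction turns this into a
   bound on [0, X], with no need for differentiability. *)
Lemma primM u v du dv : primitive u du -> primitive v dv ->
  primitive (fun t => u t * v t) (fun t => du t * v t + u t * dv t).
Proof.
move=> hu hv; have cu := prim_cont hu; have cv := prim_cont hv.
have [Idu _] := hu; have [Idv _] := hv.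
pose dw t := du t * v t + u t * dv t.
have Idw : Lint dw.
  apply: LintD; first exact: LintM.
  by apply: (@eq_Lint (fun t => dv t * u t)) => [t _|]; [rewrite mulrC|exact: LintM].
split => // X X0.
pose D x := u x * v x - int0 dw x.
pose p t := `|du t| + `|dv t|.
have Ip : Lint p by apply: LintD; exact: Lint_norm.
have key x y w : 0 <= x <= y -> (forall t, x <= t <= y -> `|v y - v t| <= w) ->
    (forall t, x <= t <= y -> `|u x - u t| <= w) ->
    `|D y - D x| <= w * (int0 p y - int0 p x).
  move=> xy vw uw.
  (* Freezing v at y and u at x linearises the product: v(y) u(t) + u(x) v(t) increases by exactly
     u(y) v(y) - u(x) v(x) between x and y. *)
  have hE : primitive (fun t => v y * u t + u x * v t - int0 dw t)
               (fun t => v y * du t + u x * dv t - dw t).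
    by apply: primB; [apply: primD; exact: primZ|exact: prim_int0].
  have hP : primitive (fun t => w * int0 p t) (fun t => w * p t) by apply/primZ/prim_int0.
  have bnd t : x <= t <= y -> `|v y * du t + u x * dv t - dw t| <= w * p t.
    move=> xty; rewrite [X in `|X|](_ : _ = du t * (v y - v t) + dv t * (u x - u t)); last first.
      by rewrite /dw; ring.
    apply: (le_trans (ler_normD _ _)); rewrite !normrM mulrDr !(mulrC w).
    by apply: lerD; apply: ler_wpM2l => //; [exact: vw|exact: uw].
  have up := prim_le hE hP xy; have lo := prim_le (primN hP) hE xy.
  rewrite [D y - D x](_ : _ = v y * u y + u x * v y - int0 dw y -
      (v y * u x + u x * v x - int0 dw x)); last by rewrite /D; ring.
  rewrite mulrBr ler_norml up ?andbT; last first.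
    by move=> t /bnd; rewrite ler_norml => /andP[].
  apply: le_trans (lo _); first by rewrite opprB addrC opprK.
  by move=> t /bnd; rewrite ler_norml => /andP[].
have bound e : 0 < e -> `|D X - D 0| <= e * int0 p X.
  move=> e0; pose Q x := `|D x - D 0| <= e * int0 p x.
  apply: (@real_induction Q X) => //; last by rewrite X0 lexx.
  - by rewrite /Q subrr normr0 int0_at0 mulr0.
  - move=> x /andP[x0 xX] Qx.
    have xX' : 0 <= x <= X by rewrite x0 ltW.
    (* The oscillation of v is measured from y, hence passes through x and costs two halves of e. *)
    have e20 : 0 < e / 2 by lra.
    have [d1 d10 H1] := (cont0P u).1 cu X x (e / 2) xX' e20.
    have [d2 d20 H2] := (cont0P v).1 cv X x (e / 2) xX' e20.
    exists (Num.min d1 d2); first by rewrite lt_min d10.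
    move=> y /andP[xy]; rewrite -ltrBlDl lt_min => /andP[yd1 yd2] yX.
    have near t : x <= t <= y -> `|u t - u x| < e / 2 /\ `|v t - v x| < e / 2.
      move=> /andP[xt ty]; have xt0 : 0 <= t - x by rewrite subr_ge0.
      have tX : 0 <= t <= X by rewrite (le_trans x0)//= (le_trans ty).
      split; [apply: H1 => //|apply: H2 => //]; rewrite ger0_norm//.
        by apply: le_lt_trans yd1; rewrite lerD2r.
      by apply: le_lt_trans yd2; rewrite lerD2r.
    rewrite /Q (_ : D y - D 0 = (D y - D x) + (D x - D 0)); last by ring.
    apply: (le_trans (ler_normD _ _)).
    rewrite (_ : e * int0 p y = e * (int0 p y - int0 p x) + e * int0 p x); last by ring.
    apply: lerD; last by apply: Qx; rewrite x0 lexx.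
    apply: key; first by rewrite x0.
      move=> t xty; have [_ +] := near t xty.
      have [|_] := near y; first by rewrite xy lexx.
      by rewrite !ltr_norml !ler_norml => /andP[? ?] /andP[? ?]; apply/andP; split; lra.
    move=> t xty; have [+ _] := near t xty.
    by rewrite !ltr_norml !ler_norml => /andP[? ?]; apply/andP; split; lra.
  - move=> x /andP[x0 xX] Qx.
    have cD : cont0 (fun t => D t - D 0).
      by apply: cont0B; [apply: cont0B; [exact: cont0M|exact: int0_cont]|exact: cont0_cst].
    have cP : cont0 (fun t => e * int0 p t).
      by apply: cont0M; [exact: cont0_cst|exact: int0_cont].
    rewrite /Q ler_norml; apply/andP; split; rewrite -subr_ge0.
      rewrite opprK; apply: (@cont0_ge0_left (fun t => D t - D 0 + e * int0 p t)) => //.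
        exact: cont0D.
      by move=> y /Qx; rewrite /Q ler_norml => /andP[]; lra.
    apply: (@cont0_ge0_left (fun t => e * int0 p t - (D t - D 0))) => //.
      exact: cont0B.
    by move=> y /Qx; rewrite /Q ler_norml => /andP[]; lra.
have : D X - D 0 = 0.
  have P0 : 0 <= int0 p X by apply: int0_ge0 => t _; rewrite addr_ge0.
  apply/eqP; rewrite -normr_le0 leNgt; apply/negP => D0.
  (* With this e the bound e * [int0 p X] is less than half of |D X - D 0|. *)
  have := bound (`|D X - D 0| / (2 * (int0 p X + 1))).
  have P1 : 0 < 2 * (int0 p X + 1) by lra.
  rewrite divr_gt0// => /(_ isT); rewrite mulrAC ler_pdivlMr//; nra.
by rewrite /D int0_at0 -/dw; lra.
Qed.

End Calculus.

(** * Energy comparison for canonical systems *)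

Section Energy.
Variable R : realType.
Implicit Types (u du p q : R -> R) (x t : R).

Lemma prim_int0E u du x : primitive u du -> 0 <= x -> int0 du x = u x - u 0.
Proof. by move=> [_ uE] x0; rewrite (uE x)// addrAC subrr add0r. Qed.

Lemma discriminant_le0 (a b c : R) : 0 <= c ->
  (forall r, 0 <= a + 2 * b * r + c * r ^+ 2) -> b ^+ 2 <= a * c.
Proof.
rewrite le_eqVlt => /orP[/eqP<-|c0] H.
  have [->|b0] := eqVneq b 0; first by rewrite expr0n mulr0.
  (* For c = 0 the expression is affine in r; this r gives it the value -1. *)
  have := H (- (a + 1) / (2 * b)).
  rewrite (_ : a + _ + _ = -1); [lra|by field].
have := H (- b / c); rewrite (_ : a + _ + _ = (a * c - b ^+ 2) / c).
  by rewrite pmulr_lge0 ?invr_gt0// subr_ge0.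
by field; rewrite gt_eqF.
Qed.

Variables H1 H2 h : R -> R.
Hypotheses (cH1 : cont0 H1) (cH2 : cont0 H2) (ch : cont0 h).
Hypothesis H1_gt0 : forall t, 0 <= t -> 0 < H1 t.
Hypothesis detH : forall t, 0 <= t -> H1 t * H2 t = 1 + h t ^+ 2.

(** The form of the Hamiltonian with diagonal [H1], [H2] and off-diagonal entry [h], on real
    vectors; the energy of a complex vector is the sum over its real and imaginary parts. *)
Definition qform t (p q : R) : R := H1 t * p ^+ 2 + H2 t * q ^+ 2 + 2 * h t * (p * q).

Lemma qform_ge0 t (p q : R) : 0 <= t -> 0 <= qform t p q.
Proof.
move=> t0; rewrite -(pmulr_rge0 _ (H1_gt0 t0)).
rewrite (_ : _ * _ = (H1 t * p + h t * q) ^+ 2 + (H1 t * H2 t - h t ^+ 2) * q ^+ 2).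
  by rewrite detH// addrK mul1r addr_ge0 ?sqr_ge0.
by rewrite /qform; ring.
Qed.

Let aH1 := prim_int0 (cont0_Lint cH1).
Let aH2 := prim_int0 (cont0_Lint cH2).
Let ah := prim_int0 (cont0_Lint ch).

Lemma cont0_qform p q : cont0 p -> cont0 q -> cont0 (fun t => qform t (p t) (q t)).
Proof.
move=> cp cq; apply: cont0D.
  by apply: cont0D; apply: cont0M => //; exact: cont0X.
by apply: cont0M; apply: cont0M => //; exact: cont0_cst.
Qed.

Lemma int0_qform_cst (p q : R) x : 0 <= x -> int0 (fun t => qform t p q) x =
  p ^+ 2 * int0 H1 x + q ^+ 2 * int0 H2 x + 2 * (p * q) * int0 h x.
Proof.
move=> x0.
have hA : primitive (fun x => p ^+ 2 * int0 H1 x + q ^+ 2 * int0 H2 x + 2 * (p * q) * int0 h x)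
   (fun t => qform t p q).
  apply: eq_prim (primD (primD (primZ (p ^+ 2) aH1) (primZ (q ^+ 2) aH2))
                        (primZ (2 * (p * q)) ah)) => //.
  by move=> t t0; rewrite /qform; ring.
by rewrite (prim_int0E hA x0) !int0_at0; ring.
Qed.

Lemma int0_H1_ge0 x : 0 <= int0 H1 x.
Proof. by apply: int0_ge0 => t t0; exact/ltW/H1_gt0. Qed.

Lemma int0_H2_ge0 x : 0 <= int0 H2 x.
Proof.
apply: int0_ge0 => t t0; rewrite -(pmulr_rge0 _ (H1_gt0 t0)) detH//.
by rewrite addr_ge0 ?sqr_ge0.
Qed.

Lemma int0_qform_cst_ge0 (p q : R) x : 0 <= x ->
  0 <= p ^+ 2 * int0 H1 x + q ^+ 2 * int0 H2 x + 2 * (p * q) * int0 h x.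
Proof. by move=> x0; rewrite -int0_qform_cst//; apply: int0_ge0 => t; exact: qform_ge0. Qed.

(** The integrated Hamiltonian is positive semidefinite, so its determinant is nonnegative. *)
Lemma int0_h_sqr_le x : 0 <= x -> int0 h x ^+ 2 <= int0 H1 x * int0 H2 x.
Proof.
move=> x0; apply: discriminant_le0; first exact: int0_H2_ge0.
by move=> r; have := int0_qform_cst_ge0 1 r x0; lra.
Qed.

(* tr(adj H(x) * int_0^x H): the squared Hilbert-Schmidt norm of the kernel row at x *)
Definition hs_row x := H1 x * int0 H2 x + H2 x * int0 H1 x - 2 * h x * int0 h x.

Lemma cont0_hs_row : cont0 hs_row.
Proof.
have c1 := prim_cont aH1; have c2 := prim_cont aH2; have c3 := prim_cont ah.
apply: cont0B; first by apply: cont0D; exact: cont0M.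
by apply: cont0M => //; apply: cont0M => //; exact: cont0_cst.
Qed.

(** By det H = 1, [H1 x * hs_row x] is the integrated form at the vector (- h x, H1 x) plus
    [int0 H1 x]. *)
Lemma hs_row_ge0 x : 0 <= x -> 0 <= hs_row x.
Proof.
move=> x0; rewrite -(pmulr_rge0 _ (H1_gt0 x0)).
have S := int0_qform_cst_ge0 (- h x) (H1 x) x0; have S1 := int0_H1_ge0 x.
have -> : H1 x * hs_row x = (H1 x * H2 x) * int0 H1 x + H1 x ^+ 2 * int0 H2 x
    - 2 * H1 x * h x * int0 h x by rewrite /hs_row; ring.
by rewrite detH//; lra.
Qed.

(** Jacobi's formula: [hs_row] is the density of the determinant of the integrated Hamiltonian,
    which is at most the product of its diagonal entries. *)
Lemma int0_hs_row_le x : 0 <= x -> int0 hs_row x <= int0 H1 x * int0 H2 x.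
Proof.
move=> x0; have hA : primitive (fun x => int0 H1 x * int0 H2 x - int0 h x * int0 h x) hs_row.
  by apply: eq_prim (primB (primM aH1 aH2) (primM ah ah)) => // t t0; rewrite /hs_row; ring.
by rewrite (prim_int0E hA x0) !int0_at0; have := sqr_ge0 (int0 h x); lra.
Qed.

Section CauchySchwarz.
Variables p q : R -> R.
Hypotheses (cp : cont0 p) (cq : cont0 q).
Let X := int0 (fun t => h t * p t + H2 t * q t).
Let Y := int0 (fun t => H1 t * p t + h t * q t).

(** (-X, Y) is the rotated integral of H (p, q). Its form L at x is the energy pairing of (p, q)
    with the constant vector (n, m), which is H(x)(-X, Y) rotated by a right angle. Cauchy-Schwarz
    gives L^2 <= E C, and C <= [hs_row x] L lets one factor L be divided out. *)
Lemma energy_cauchy_schwarz x : 0 <= x ->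
  qform x (- X x) (Y x) <= hs_row x * int0 (fun t => qform t (p t) (q t)) x.
Proof.
move=> x0.
have aX : primitive X (fun t => h t * p t + H2 t * q t).
  by apply/prim_int0/cont0_Lint; apply: cont0D; exact: cont0M.
have aY : primitive Y (fun t => H1 t * p t + h t * q t).
  by apply/prim_int0/cont0_Lint; apply: cont0D; exact: cont0M.
have aE : primitive (int0 (fun t => qform t (p t) (q t))) (fun t => qform t (p t) (q t)).
  exact/prim_int0/cont0_Lint/cont0_qform.
have [X0 Y0] : X 0 = 0 /\ Y 0 = 0 by rewrite /X /Y !int0_at0.
set E := int0 _ x.
set m := H1 x * X x - h x * Y x; set n := H2 x * Y x - h x * X x.
have LE : qform x (- X x) (Y x) = m * X x + n * Y x by rewrite /qform /m /n; ring.
set L := qform _ _ _ in LE *.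
have L0 : 0 <= L by exact: qform_ge0.
pose C := n ^+ 2 * int0 H1 x + m ^+ 2 * int0 H2 x + 2 * (n * m) * int0 h x.
have C0 : 0 <= C by exact: int0_qform_cst_ge0.
have L2 : L ^+ 2 <= E * C.
  apply: discriminant_le0 => // r.
  have hA : primitive (fun x => int0 (fun t => qform t (p t) (q t)) x
      + (2 * r) * (m * X x + n * Y x) + r ^+ 2 * int0 (fun t => qform t n m) x)
      (fun t => qform t (p t + r * n) (q t + r * m)).
    apply: eq_prim (primD (primD aE (primZ (2 * r) (primD (primZ m aX) (primZ n aY))))
                      (primZ (r ^+ 2) (prim_int0 _))) => //.
      by move=> t t0; rewrite /qform; ring.
    by apply/cont0_Lint/cont0_qform; exact: cont0_cst.
  rewrite (_ : E + 2 * L * r + C * r ^+ 2 =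
    int0 (fun t => qform t (p t + r * n) (q t + r * m)) x).
    by apply: int0_ge0 => t; exact: qform_ge0.
  by rewrite (prim_int0E hA x0) !int0_at0 X0 Y0 -LE int0_qform_cst// -/C -/E; ring.
(* Polarised Cayley-Hamilton for 2 x 2 matrices: with M = int H, one has H adj(M) H = tr(adj(H) M) H
   - det(H) M, and the last term has a sign. *)
have CL : C <= hs_row x * L.
  rewrite -subr_ge0.
  have := int0_qform_cst_ge0 (X x) (- Y x) x0.
  have -> : hs_row x * L - C = (H1 x * H2 x - h x ^+ 2) * (X x ^+ 2 * int0 H1 x +
      (- Y x) ^+ 2 * int0 H2 x + 2 * (X x * - Y x) * int0 h x).
    by rewrite LE /hs_row /C /m /n; ring.
  by rewrite detH// addrK mul1r.
have k0 := hs_row_ge0 x0.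
have E0 : 0 <= E by apply: int0_ge0 => t; exact: qform_ge0.
move: (L0); rewrite le_eqVlt => /orP[/eqP<-|Lgt0]; first exact: mulr_ge0.
rewrite -(ler_pM2l Lgt0) -expr2 (le_trans L2)// (le_trans (ler_wpM2l E0 CL))//.
by rewrite le_eqVlt; apply/orP; left; apply/eqP; ring.
Qed.

End CauchySchwarz.

(* The constant initial vector differs from the solution by a Volterra operator of
   Hilbert-Schmidt norm at most 1/2, so its energy norm is at most 3/2 that of the solution. *)
Lemma energy_comparison (e L : R) (p1 p2 q1 q2 : R -> R) : 0 <= L ->
  4 * e ^+ 2 * (int0 H1 L * int0 H2 L) <= 1 ->
  primitive p1 (fun t => - e * (h t * p2 t + H2 t * q2 t)) ->
  primitive q1 (fun t => e * (H1 t * p2 t + h t * q2 t)) ->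
  primitive p2 (fun t => e * (h t * p1 t + H2 t * q1 t)) ->
  primitive q2 (fun t => - e * (H1 t * p1 t + h t * q1 t)) ->
  int0 (fun t => qform t (p1 0) (q1 0) + qform t (p2 0) (q2 0)) L <=
  9 / 4 * int0 (fun t => qform t (p1 t) (q1 t) + qform t (p2 t) (q2 t)) L.
Proof.
move=> L0 eL ap1 aq1 ap2 aq2.
have [cp1 cq1] := (prim_cont ap1, prim_cont aq1).
have [cp2 cq2] := (prim_cont ap2, prim_cont aq2).
set N := fun t => qform t (p1 t) (q1 t) + qform t (p2 t) (q2 t).
have cN : cont0 N by apply: cont0D; exact: cont0_qform.
have aN := prim_int0 (cont0_Lint cN).
have N0 t : 0 <= t -> 0 <= N t by move=> t0; rewrite addr_ge0 ?qform_ge0.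
have M0 : 0 <= int0 N L by exact: int0_ge0.
(* Young's inequality with weight 1/2; the defect is half the form at c + 2 (c - a), d + 2 (d - b).
   This weight is optimal for a relative error 1/2: 3/2 + 3 * 1/4 = 9/4 = (1 + 1/2)^2. *)
have split3 t (a b c d : R) : 0 <= t ->
    qform t a b <= 3 / 2 * qform t c d + 3 * qform t (c - a) (d - b).
  move=> t0; have := qform_ge0 (c + 2 * (c - a)) (d + 2 * (d - b)) t0.
  by rewrite /qform; lra.
have delta u du c x : 0 <= x -> primitive u (fun t => c * du t) -> Lint du ->
    u x - u 0 = c * int0 du x.
  by move=> x0 au Idu; rewrite -(prim_int0E au x0) int0Z.
have LX p q : cont0 p -> cont0 q -> Lint (fun t => h t * p t + H2 t * q t).
  by move=> cp cq; apply/cont0_Lint; apply: cont0D; exact: cont0M.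
have LY p q : cont0 p -> cont0 q -> Lint (fun t => H1 t * p t + h t * q t).
  by move=> cp cq; apply/cont0_Lint; apply: cont0D; exact: cont0M.
have dist x : 0 <= x <= L ->
    qform x (p1 x - p1 0) (q1 x - q1 0) + qform x (p2 x - p2 0) (q2 x - q2 0) <=
    e ^+ 2 * hs_row x * int0 N L.
  move=> /andP[x0 xL].
  rewrite (delta _ _ _ _ x0 ap1) ?(delta _ _ _ _ x0 aq1) ?(delta _ _ _ _ x0 ap2);
    rewrite ?(delta _ _ _ _ x0 aq2); do ?[exact: LX|exact: LY].
  (* The spectral parameter i e is imaginary, so each real pair is driven by the other one: the
     second pair bounds the displacement of the first, and conversely. *)
  have C1 := energy_cauchy_schwarz cp2 cq2 x0.
  have C2 := energy_cauchy_schwarz cp1 cq1 x0.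
  have NxL : int0 N x <= int0 N L.
    by apply: (prim_mono aN); rewrite ?x0// => t /andP[xt _]; apply: N0; exact: le_trans xt.
  have NE : int0 N x = int0 (fun t => qform t (p1 t) (q1 t)) x +
      int0 (fun t => qform t (p2 t) (q2 t)) x.
    by rewrite int0D//; apply/cont0_Lint/cont0_qform.
  have sc (c a b : R) : qform x (- c * a) (c * b) = c ^+ 2 * qform x (- a) b.
    by rewrite /qform; ring.
  have sc' (c a b : R) : qform x (c * a) (- c * b) = c ^+ 2 * qform x (- a) b.
    by rewrite /qform; ring.
  rewrite sc sc' -mulrDr -mulrA; apply: ler_wpM2l; first exact: sqr_ge0.
  apply: le_trans (ler_wpM2l (hs_row_ge0 x0) NxL); rewrite NE mulrDr addrC.
  exact: lerD.
have ck := cont0_hs_row.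
have step : int0 (fun t => qform t (p1 0) (q1 0) + qform t (p2 0) (q2 0)) L <=
    int0 (fun t => 3 / 2 * N t + (3 * e ^+ 2 * int0 N L) * hs_row t) L.
  apply: le_int0 => //.
  - by apply/cont0_Lint; apply: cont0D; apply: cont0_qform; exact: cont0_cst.
  - by apply/cont0_Lint; apply: cont0D; apply: cont0M => //; exact: cont0_cst.
  - move=> t tL; have [t0 _] := andP tL; have := dist t tL.
    have := split3 t (p1 0) (q1 0) (p1 t) (q1 t) t0.
    have := split3 t (p2 0) (q2 0) (p2 t) (q2 t) t0.
    by rewrite /N; lra.
apply: (le_trans step).
rewrite int0D//; [|exact/LintZ/cont0_Lint|exact/LintZ/cont0_Lint].
rewrite !int0Z//; [|exact/cont0_Lint|exact/cont0_Lint].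
have hk := int0_hs_row_le L0.
have := ler_wpM2l (mulr_ge0 (sqr_ge0 e) M0) hk.
have := ler_wpM2l M0 eL.
lra.
Qed.

End Energy.

(** * Wronskians of Dirac systems *)

Section ComplexCalculus.
Variable R : realType.
Implicit Types (u v du dv : R -> R[i]) (z w c : R[i]) (x t : R).

Definition cprimitive u du :=
  primitive (fun t => complex.Re (u t)) (fun t => complex.Re (du t)) /\
  primitive (fun t => complex.Im (u t)) (fun t => complex.Im (du t)).

Lemma ReM z w :
  complex.Re (z * w) = complex.Re z * complex.Re w - complex.Im z * complex.Im w.
Proof. by case: z w => [? ?] [? ?]. Qed.

Lemma ImM z w :
  complex.Im (z * w) = complex.Re z * complex.Im w + complex.Im z * complex.Re w.
Proof. by case: z w => [? ?] [? ?]. Qed.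

Lemma ReD z w : complex.Re (z + w) = complex.Re z + complex.Re w.
Proof. by case: z w => [? ?] [? ?]. Qed.

Lemma ImD z w : complex.Im (z + w) = complex.Im z + complex.Im w.
Proof. by case: z w => [? ?] [? ?]. Qed.

Lemma ReN z : complex.Re (- z) = - complex.Re z.
Proof. by case: z. Qed.

Lemma ImN z : complex.Im (- z) = - complex.Im z.
Proof. by case: z. Qed.

Lemma Re_conjc z : complex.Re (conjc z) = complex.Re z.
Proof. by case: z. Qed.

Lemma Im_conjc z : complex.Im (conjc z) = - complex.Im z.
Proof. by case: z. Qed.

Definition ReImE := (ReM, ImM, ReD, ImD, ReN, ImN, Re_conjc, Im_conjc).

Lemma complex_ext z w : complex.Re z = complex.Re w -> complex.Im z = complex.Im w -> z = w.
Proof. by case: z w => [? ?] [? ?] /= -> ->. Qed.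

Lemma conjcM z w : conjc (z * w) = conjc z * conjc w.
Proof. exact: rmorphM. Qed.

Lemma conjcD z w : conjc (z + w) = conjc z + conjc w.
Proof. exact: rmorphD. Qed.

Lemma conjcN z : conjc (- z) = - conjc z.
Proof. exact: rmorphN. Qed.

Definition conjcE := (conjcM, conjcD, conjcN).

Lemma eq_cprim u v du dv : (forall x, 0 <= x -> u x = v x) ->
  (forall x, 0 <= x -> du x = dv x) -> cprimitive u du -> cprimitive v dv.
Proof.
by move=> uv duv [ur ui]; split; [move: ur|move: ui];
  apply: eq_prim => x x0; rewrite ?uv ?duv.
Qed.

Lemma cprimD u v du dv : cprimitive u du -> cprimitive v dv ->
  cprimitive (fun t => u t + v t) (fun t => du t + dv t).
Proof.
move=> [ur ui] [vr vi]; split.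
  by apply: eq_prim (primD ur vr) => x _; rewrite !ReImE.
by apply: eq_prim (primD ui vi) => x _; rewrite !ReImE.
Qed.

Lemma cprimM u v du dv : cprimitive u du -> cprimitive v dv ->
  cprimitive (fun t => u t * v t) (fun t => du t * v t + u t * dv t).
Proof.
move=> [ur ui] [vr vi]; split.
  apply: eq_prim (primB (primM ur vr) (primM ui vi)) => x _; rewrite !ReImE//; ring.
apply: eq_prim (primD (primM ur vi) (primM ui vr)) => x _; rewrite !ReImE//; ring.
Qed.

Lemma cprim_cst c : cprimitive (fun=> c) (fun=> 0).
Proof. by split; exact: prim_cst. Qed.

Lemma cprimZ c u du : cprimitive u du -> cprimitive (fun t => c * u t) (fun t => c * du t).
Proof.
by move=> hu; apply: eq_cprim (cprimM (cprim_cst c) hu) => // x _; rewrite mul0r add0r.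
Qed.

Lemma cprimB u v du dv : cprimitive u du -> cprimitive v dv ->
  cprimitive (fun t => u t - v t) (fun t => du t - dv t).
Proof.
by move=> hu hv; apply: eq_cprim (cprimD hu (cprimZ (-1) hv)) => // x _; rewrite mulN1r.
Qed.

Lemma cprim_conjc u du : cprimitive u du ->
  cprimitive (fun t => conjc (u t)) (fun t => conjc (du t)).
Proof.
move=> [ur ui]; split.
  by apply: eq_prim ur => x _; rewrite !ReImE.
by apply: eq_prim (primN ui) => x _; rewrite !ReImE.
Qed.

Lemma cprim_const u du x : cprimitive u du -> (forall t, 0 <= t -> du t = 0) -> 0 <= x ->
  u x = u 0.
Proof.
move=> [ur ui] du0 x0; apply: complex_ext; apply/eqP; rewrite -subr_eq0.
  rewrite -(prim_int0E ur x0) (@eq_int0 _ _ (fun=> 0)) ?int0_cst ?mul0r//.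
  by move=> t /du0 ->.
rewrite -(prim_int0E ui x0) (@eq_int0 _ _ (fun=> 0)) ?int0_cst ?mul0r//.
by move=> t /du0 ->.
Qed.

Lemma cabs2M z w : cabs2 (z * w) = cabs2 z * cabs2 w.
Proof. by rewrite /cabs2 !ReImE; ring. Qed.

Lemma cabs2N z : cabs2 (- z) = cabs2 z.
Proof. by rewrite /cabs2 !ReImE; ring. Qed.

Lemma cabs2_ge0 z : 0 <= cabs2 z.
Proof. by rewrite addr_ge0 ?sqr_ge0. Qed.

Lemma cabs2_eq0 z : cabs2 z = 0 -> z = 0.
Proof.
move=> /eqP; rewrite paddr_eq0 ?sqr_ge0// !sqrf_eq0 => /andP[/eqP ? /eqP ?].
exact: complex_ext.
Qed.

Lemma cabs2_conjc z : cabs2 (conjc z) = cabs2 z.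
Proof. by rewrite /cabs2 !ReImE; ring. Qed.

Lemma mulC_conjc z : z * conjc z = Complex (cabs2 z) 0.
Proof. by apply: complex_ext; rewrite /cabs2 /= !ReImE; ring. Qed.

Lemma cabs_sqr z : cabs z ^+ 2 = cabs2 z.
Proof. by rewrite sqr_sqrtr// cabs2_ge0. Qed.

Lemma cabs_ge0 z : 0 <= cabs z.
Proof. exact: sqrtr_ge0. Qed.

Lemma cabsM z w : cabs (z * w) = cabs z * cabs w.
Proof. by rewrite /cabs cabs2M sqrtrM// cabs2_ge0. Qed.

Lemma cabsN z : cabs (- z) = cabs z.
Proof. by rewrite /cabs cabs2N. Qed.

Lemma cabs0 : cabs (0 : R[i]) = 0.
Proof. by rewrite /cabs /cabs2 /= expr0n addr0 sqrtr0. Qed.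

Lemma cabs_gt0 z : z != 0 -> 0 < cabs z.
Proof.
move=> z0; rewrite lt_neqAle cabs_ge0 andbT eq_sym; apply: contra z0.
by move=> /eqP z0; apply/eqP/cabs2_eq0; rewrite -cabs_sqr z0 expr0n.
Qed.

Lemma cabs_div z w : w != 0 -> cabs (z / w) = cabs z / cabs w.
Proof.
move=> w0; apply: (@mulIf _ (cabs w)); first by rewrite gt_eqF// cabs_gt0.
by rewrite -cabsM !divfK// gt_eqF// cabs_gt0.
Qed.

End ComplexCalculus.

(** * Conjugation symmetry and Wronskian identities *)

Section DiracSystem.
Variables (R : realType) (phi : R -> R[i]).
Implicit Types (U V W : R -> R[i] * R[i]) (z w c : R[i]) (x t : R).

Lemma dirac_rhs1E z V t : dirac_rhs1 phi z V t =
  - Complex 0 1 * z * (V t).1 + Complex 0 1 * phi t * (V t).2.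
Proof. by rewrite /dirac_rhs1 complexiE. Qed.

Lemma dirac_rhs2E z V t : dirac_rhs2 phi z V t =
  Complex 0 1 * z * (V t).2 - Complex 0 1 * conjc (phi t) * (V t).1.
Proof. by rewrite /dirac_rhs2 complexiE. Qed.

Definition csol z V :=
  cprimitive (fun t => (V t).1) (dirac_rhs1 phi z V) /\
  cprimitive (fun t => (V t).2) (dirac_rhs2 phi z V).

Lemma is_solP z V : is_sol phi z V <-> csol z V.
Proof.
split=> [sol|[[[I1r E1r] [I1i E1i]] [[I2r E2r] [I2i E2i]]] x x0].
  by split; split; split => x /sol [[? ?] [? ?] E1 E2] //=; rewrite ?E1 ?E2 !ReImE.
split; [by split; [exact: I1r|exact: I1i]|by split; [exact: I2r|exact: I2i]| |].
  by apply: complex_ext; rewrite !ReImE; [exact: E1r|exact: E1i].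
by apply: complex_ext; rewrite !ReImE; [exact: E2r|exact: E2i].
Qed.

Lemma csol_lincomb z c d U V : csol z U -> csol z V ->
  csol z (fun t => (c * (U t).1 + d * (V t).1, c * (U t).2 + d * (V t).2)).
Proof.
move=> [U1 U2] [V1 V2]; split.
  by apply: eq_cprim (cprimD (cprimZ c U1) (cprimZ d V1)) => //= t _;
    rewrite !dirac_rhs1E /=; ring.
by apply: eq_cprim (cprimD (cprimZ c U2) (cprimZ d V2)) => //= t _;
  rewrite !dirac_rhs2E /=; ring.
Qed.

(** The symmetry behind the SU(1,1) form of T: at a real parameter it exchanges the two columns. *)
Definition sharp V t : R[i] * R[i] := (conjc (V t).2, conjc (V t).1).

Lemma csol_sharp z V : csol z V -> csol (conjc z) (sharp V).
Proof.
have conj_i : conjc (Complex 0 1 : R[i]) = - Complex 0 1 by apply: complex_ext => //=; ring.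
move=> [V1 V2]; split.
  apply: eq_cprim (cprim_conjc V2) => //= t _.
  by rewrite dirac_rhs1E dirac_rhs2E !conjcE conj_i conjcK /=; ring.
apply: eq_cprim (cprim_conjc V1) => //= t _.
by rewrite dirac_rhs1E dirac_rhs2E !conjcE conj_i /=; ring.
Qed.

Definition wronskian U V t := (U t).1 * (V t).2 - (U t).2 * (V t).1.

(** The potential terms cancel even for two different spectral parameters. The case z = w gives
    uniqueness, V = [sharp U] the energy identity, and w = [lam] the equations for the
    coefficients. *)
Lemma cprim_wronskian z w U V : csol z U -> csol w V ->
  cprimitive (wronskian U V)
    (fun t => - Complex 0 1 * (z - w) * ((U t).1 * (V t).2 + (U t).2 * (V t).1)).
Proof.
move=> [U1 U2] [V1 V2].
apply: eq_cprim (cprimB (cprimM U1 V2) (cprimM U2 V1)) => //= t _.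
by rewrite !dirac_rhs1E !dirac_rhs2E; ring.
Qed.

Lemma wronskian_const z U V x : csol z U -> csol z V -> 0 <= x ->
  wronskian U V x = wronskian U V 0.
Proof.
move=> hU hV; apply: cprim_const (cprim_wronskian hU hV) _ => t _.
by rewrite subrr mulr0 mul0r.
Qed.

(* Cramer's rule with constant Wronskians, which also gives uniqueness *)
Lemma csol_repr z T1 T2 V x : csol z T1 -> csol z T2 -> csol z V ->
  T1 0 = (1, 0) -> T2 0 = (0, 1) -> 0 <= x ->
  V x = ((V 0).1 * (T1 x).1 + (V 0).2 * (T2 x).1, (V 0).1 * (T1 x).2 + (V 0).2 * (T2 x).2).
Proof.
move=> h1 h2 hV T10 T20 x0.
have := wronskian_const h1 h2 x0; have := wronskian_const hV h2 x0.
have := wronskian_const h1 hV x0; rewrite /wronskian T10 T20 /=.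
rewrite !(mulr0, mul0r, subr0, mulr1, mul1r) => E2 E1 E0.
case: (V x) E1 E2 => v1 v2 /= E1 E2.
congr pair; [rewrite -[LHS](mulr1)|rewrite -[LHS](mulr1)]; rewrite -E0 -E1 -E2; ring.
Qed.

End DiracSystem.

(** * Expansion of the Weyl solution *)

Section WeylSolution.
Variables (R : realType) (phi : R -> R[i]).
Implicit Types (U V Psi : R -> R[i] * R[i]) (z : R[i]) (x t L : R).
Notation mu := (@lebesgue_measure R).

Lemma csol_cont z V : csol phi z V ->
  [/\ cont0 (fun t => complex.Re (V t).1), cont0 (fun t => complex.Im (V t).1),
      cont0 (fun t => complex.Re (V t).2) & cont0 (fun t => complex.Im (V t).2)].
Proof. by move=> [[/prim_cont ? /prim_cont ?] [/prim_cont ? /prim_cont ?]]. Qed.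

Definition cabs2V (v : R[i] * R[i]) := cabs2 v.1 + cabs2 v.2.

Lemma cont0_cabs2 (f : R -> R[i]) : cont0 (fun t => complex.Re (f t)) ->
  cont0 (fun t => complex.Im (f t)) -> cont0 (fun t => cabs2 (f t)).
Proof. by move=> cr ci; apply: cont0D; exact: cont0X. Qed.

Lemma cont0_cabs2V z V : csol phi z V -> cont0 (fun t => cabs2V (V t)).
Proof. by move/csol_cont => [? ? ? ?]; apply: cont0D; exact: cont0_cabs2. Qed.

(** The current is the Wronskian of V with [sharp V], which solves at the conjugate parameter; - i
    (z - z^-) = 2 Im z. *)
Lemma prim_current z V : csol phi z V ->
  primitive (fun t => cabs2 (V t).1 - cabs2 (V t).2)
            (fun t => 2 * complex.Im z * cabs2V (V t)).
Proof.
move=> hV; have [+ _] := cprim_wronskian hV (csol_sharp hV).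
apply: eq_prim => t _; rewrite /wronskian /sharp /= /cabs2V !mulC_conjc.
  by rewrite !ReImE.
by rewrite !ReImE /=; ring.
Qed.

Lemma cont0_measurable (f : R -> R) : cont0 f -> measurable_fun (`[0, +oo[ : set R) f.
Proof.
move=> /cont0P cf; apply: subspace_continuous_measurable_fun => //.
apply/subspace_continuousP => x /=; rewrite in_itv/= andbT => x0.
apply/cvgrPdist_lt => e e0.
have xx1 : 0 <= x <= x + 1 by apply/andP; split => //; lra.
have [d d0 Hd] := cf (x + 1) x e xx1 e0.
(* Radius at most 1 keeps the neighbours inside [0, x + 1], where the modulus d applies. *)
rewrite near_withinE; exists (Num.min d 1); first by rewrite /= lt_min d0 ltr01.
move=> /= y; rewrite lt_min => /andP[yd y1].
rewrite in_itv/= andbT => y0; rewrite distrC; apply: Hd; last by rewrite distrC.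
by rewrite y0 /=; move: y1; rewrite ltr_norml => /andP[]; lra.
Qed.

Lemma int0_le_integral (f : R -> R) : cont0 f -> (forall t, 0 <= f t) ->
  (\int[mu]_(t in `[0%R, +oo[) (f t)%:E < +oo)%E ->
  exists K, forall x, 0 <= x -> int0 f x <= K.
Proof.
move=> cf f0 foo; exists (fine (\int[mu]_(t in `[0%R, +oo[) (f t)%:E)) => x x0.
have I0 D : (0 <= \int[mu]_(t in D) (f t)%:E)%E by apply: integral_ge0 => t _; rewrite lee_fin.
have le : (\int[mu]_(t in `[0%R, x]) (f t)%:E <= \int[mu]_(t in `[0%R, +oo[) (f t)%:E)%E.
  apply: ge0_subset_integral => //=.
  - by apply/measurable_EFinP; exact: cont0_measurable.
  - by move=> t _; rewrite lee_fin.
  - by move=> t /=; rewrite !in_itv/= andbT => /andP[].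
by apply: fine_le => //; rewrite ge0_fin_numE//; exact: le_lt_trans foo.
Qed.

(** The current J is nondecreasing with density 2 Im z |Psi|^2. If it were positive at L, then
    |Psi|^2 >= J >= J L > 0 from L on, against square integrability; so J L <= 0, and the increment
    of J on [0, L] is at most - J 0. *)
Lemma weyl_energy z Psi L : csol phi z Psi -> in_L2 Psi -> 0 < complex.Im z -> 0 <= L ->
  2 * complex.Im z * int0 (fun t => cabs2V (Psi t)) L <=
  cabs2 (Psi 0).2 - cabs2 (Psi 0).1.
Proof.
move=> hP P2 z0 L0; have cN := cont0_cabs2V hP; have aJ := prim_current hP.
set J := (fun t => cabs2 (Psi t).1 - cabs2 (Psi t).2) in aJ.
set N := (fun t => cabs2V (Psi t)) in aJ cN *.
have N0 t : 0 <= N t by rewrite addr_ge0 ?cabs2_ge0.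
have J2 : J L - J 0 = 2 * complex.Im z * int0 N L.
  rewrite -(prim_int0E aJ L0); apply: int0Z => //; exact: cont0_Lint.
suff JL : J L <= 0 by rewrite -J2 /J; move: JL; rewrite /J; lra.
rewrite leNgt; apply/negP => JL.
have [K HK] := int0_le_integral cN N0 P2.
have aN := prim_int0 (cont0_Lint cN).
have K0 : 0 <= K by apply: le_trans (HK _ L0); exact: int0_ge0.
(* On an interval of this length the lower bound J L contributes K + 1, which exceeds the bound K
   for the total energy. *)
pose x := L + (K + 1) / J L.
have Lx : L <= x by rewrite /x lerDl divr_ge0 ?(ltW JL)// addr_ge0.
have x0 : 0 <= x by exact: le_trans Lx.
have NJ t : L <= t -> J L <= N t.
  move=> Lt; have JN : J t <= N t.
    by rewrite /J /N /cabs2V; have := cabs2_ge0 (Psi t).2; lra.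
  apply: le_trans JN; apply: (prim_mono aJ); first by rewrite L0.
  move=> u /andP[Lu _]; apply: mulr_ge0; last exact: N0.
  by apply: mulr_ge0 => //; exact: ltW.
have aC : primitive (fun t => J L * int0 (fun=> 1) t) (fun t => J L * 1).
  by apply/primZ/prim_int0/cont0_Lint/cont0_cst.
have := prim_le aC aN (x := L) (y := x).
rewrite L0 Lx !int0_cst// !mul1r => /(_ isT) H.
have {}H : J L * x - J L * L <= int0 N x - int0 N L.
  by apply: H => t /andP[Lt _]; rewrite mulr1 NJ.
have IL : 0 <= int0 N L by exact: int0_ge0.
have := HK x x0; move: H; rewrite -mulrBr /x addrAC subrr add0r mulrC divfK ?gt_eqF//.
lra.
Qed.

End WeylSolution.

(** * Solutions at the real parameter and the system for the coefficients *)

Section Transfer.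
Variables (R : realType) (phi : R -> R[i]) (lam : R) (T1 T2 : R -> R[i] * R[i]).
Hypotheses (hT1 : csol phi (Complex lam 0) T1) (hT2 : csol phi (Complex lam 0) T2).
Hypotheses (T10 : T1 0 = (1, 0)) (T20 : T2 0 = (0, 1)).
Implicit Types (V Psi : R -> R[i] * R[i]) (xi : R[i]) (x t L : R).

Lemma eq_csol z U V : (forall x, 0 <= x -> U x = V x) -> csol phi z U -> csol phi z V.
Proof.
move=> UV [U1 U2]; split.
  apply: eq_cprim U1 => x x0; first by rewrite UV.
  by rewrite !dirac_rhs1E UV.
apply: eq_cprim U2 => x x0; first by rewrite UV.
by rewrite !dirac_rhs2E UV.
Qed.

Lemma T2_sharp x : 0 <= x -> T2 x = sharp T1 x.
Proof.
move=> x0; have := csol_sharp hT1.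
have -> : conjc (Complex lam 0) = Complex lam 0 by apply: complex_ext => //=; rewrite oppr0.
move=> hS; rewrite [RHS](csol_repr hT1 hT2 hS T10 T20 x0).
have -> : sharp T1 0 = (0, 1).
  by rewrite /sharp T10; congr pair; [exact: conjc0|exact: conjc1].
by case: (T2 x) => a b; congr pair => /=; ring.
Qed.

(** This is A + xi B, the first component of the solution with initial data (1, xi). *)
Definition wave xi t := (T1 t).1 + xi * (T2 t).1.

Lemma csol_wave xi : xi * conjc xi = 1 ->
  csol phi (Complex lam 0) (fun t => (wave xi t, xi * conjc (wave xi t))).
Proof.
move=> xi1; apply: eq_csol (csol_lincomb 1 xi hT1 hT2) => x x0.
rewrite /wave mul1r; congr pair; rewrite !conjcE mulrDr mulrA xi1 T2_sharp//= !conjcK; ring.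
Qed.

Lemma wave_at0 xi : wave xi 0 = 1.
Proof. by rewrite /wave T10 T20 /= mulr0 addr0. Qed.

(** This is twice the identity |A|^2 - |B|^2 = 1, the constancy of det T. *)
Lemma wave_dual xi t : xi * conjc xi = 1 -> 0 <= t ->
  wave xi t * conjc (wave (- xi) t) + conjc (wave xi t) * wave (- xi) t = 2.
Proof.
move=> xi1 t0; have := wronskian_const hT1 hT2 t0.
rewrite /wronskian T10 T20 T2_sharp// /sharp /= mulr0 subr0 mulr1 => D.
rewrite /wave T2_sharp// /sharp /= !conjcE !conjcK.
transitivity (2 * ((T1 t).1 * conjc (T1 t).1 -
    (xi * conjc xi) * ((T1 t).2 * conjc (T1 t).2)) : R[i]); first by ring.
by rewrite xi1 mul1r D mulr1.
Qed.

Definition wave_sq xi t := cabs2 (wave xi t).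

Definition wave_cross xi t := complex.Im (wave xi t * conjc (wave (- xi) t)).

Section Direction.
Variable xi : R[i].
Hypothesis xi1 : xi * conjc xi = 1.
Local Notation f := (wave xi).
Local Notation g := (wave (- xi)).
Local Notation H1 := (wave_sq xi).
Local Notation H2 := (wave_sq (- xi)).
Local Notation h := (wave_cross xi).

Let nxi1 : - xi * conjc (- xi) = 1.
Proof. by rewrite conjcN mulrNN. Qed.

Lemma cont0_wave : cont0 (fun t => complex.Re (f t)) /\ cont0 (fun t => complex.Im (f t)).
Proof. by have [? ? _ _] := csol_cont (csol_wave xi1). Qed.

Lemma cont0_nwave : cont0 (fun t => complex.Re (g t)) /\ cont0 (fun t => complex.Im (g t)).
Proof. by have [? ? _ _] := csol_cont (csol_wave nxi1). Qed.

Lemma cont0_wave_sq : cont0 H1.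
Proof. by have [? ?] := cont0_wave; exact: cont0_cabs2. Qed.

Lemma cont0_nwave_sq : cont0 H2.
Proof. by have [? ?] := cont0_nwave; exact: cont0_cabs2. Qed.

Lemma cont0_wave_cross : cont0 h.
Proof.
have [fr fi] := cont0_wave; have [gr gi] := cont0_nwave.
apply: (@eq_cont0 _ (fun t => complex.Im (f t) * complex.Re (g t)
   - complex.Re (f t) * complex.Im (g t))); last by apply: cont0B; exact: cont0M.
by move=> t _; rewrite /h !ReImE; ring.
Qed.

Lemma wave_det t : 0 <= t -> H1 t * H2 t = 1 + h t ^+ 2.
Proof.
move=> t0; rewrite /wave_sq -(cabs2_conjc (g t)) -cabs2M /cabs2 /wave_cross; congr (_ + _).
have := congr1 (@complex.Re R) (wave_dual xi1 t0).
have -> : complex.Re 2 = 2 :> R by [].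
rewrite !ReImE => E.
by rewrite (_ : _ - _ = 1) ?expr1n//; lra.
Qed.

Lemma wave_sq_gt0 t : 0 <= t -> 0 < H1 t.
Proof.
move=> t0; rewrite lt_neqAle [0 <= _]cabs2_ge0 andbT eq_sym; apply/eqP => H10.
have := wave_det t0; rewrite H10 mul0r; have := sqr_ge0 (h t); lra.
Qed.

(** The two real pairs are the real and imaginary parts of (a, - i b): the factor - i on the second
    coefficient is what makes the Hamiltonian real symmetric. *)
Lemma wave_energyE t (a b : R[i]) :
  2 * (qform H1 H2 h t (complex.Re a) (complex.Im b) +
       qform H1 H2 h t (complex.Im a) (- complex.Re b)) =
  cabs2 (a * f t + b * g t) + cabs2 (a * conjc (f t) - b * conjc (g t)).
Proof.
rewrite /qform /wave_sq /wave_cross /cabs2.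
case: (f t) (g t) a b => [f1 f2] [g1 g2] [a1 a2] [b1 b2] /=; ring.
Qed.

Lemma weyl_comparison eps (s a b : R[i]) Psi L :
  a = s + conjc xi -> b = s - conjc xi ->
  csol phi (Complex lam eps) Psi -> Psi 0 = (s, 1) -> 0 <= L ->
  4 * eps ^+ 2 * (int0 H1 L * int0 H2 L) <= 1 ->
  cabs2 a * int0 H1 L + cabs2 b * int0 H2 L
    + 2 * (complex.Re a * complex.Im b - complex.Im a * complex.Re b) * int0 h L <=
  9 / 2 * int0 (fun t => cabs2V (Psi t)) L.
Proof.
move=> aE bE hP P0 L0 eL.
(* Doubled coefficients: 2 Psi = al (f, xi f^-) + be (g, - xi g^-). Up to a unimodular factor, each
   is the Wronskian of Psi with the other basis solution. *)
pose al t := conjc (g t) * (Psi t).1 + conjc xi * g t * (Psi t).2.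
pose be t := conjc (f t) * (Psi t).1 - conjc xi * f t * (Psi t).2.
have hi t : Complex 0 (2 * h t) = f t * conjc (g t) - conjc (f t) * g t.
  by rewrite /wave_cross; case: (f t) (g t) => [? ?] [? ?]; apply: complex_ext => /=; ring.
have hH1 t : Complex (H1 t) 0 = f t * conjc (f t) by rewrite mulC_conjc.
have hH2 t : Complex (H2 t) 0 = g t * conjc (g t) by rewrite mulC_conjc.
have D t : 0 <= t -> f t * conjc (g t) + conjc (f t) * g t = 2 by exact: wave_dual.
have two0 : (2 : R[i]) != 0 by rewrite pnatr_eq0.
have izw : - Complex 0 1 * (Complex lam eps - Complex lam 0) = Complex eps 0.
  by apply: complex_ext; rewrite !ReImE /=; ring.
have half t : 2 * Complex 0 (h t) = Complex 0 (2 * h t).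
  have -> : (2 : R[i]) = Complex 2 0 by apply: complex_ext => //=; rewrite addr0.
  by move: (h t) => y; apply: complex_ext; rewrite ?ReM ?ImM /=; ring.
have aal : cprimitive al (fun t => Complex eps 0 *
    (Complex 0 (h t) * al t + Complex (H2 t) 0 * be t)).
  apply: eq_cprim (cprimZ (- conjc xi) (cprim_wronskian hP (csol_wave nxi1))) => t t0.
    rewrite /wronskian /al /=.
    transitivity (xi * conjc xi * conjc (g t) * (Psi t).1 + conjc xi * g t * (Psi t).2).
      by ring.
    by rewrite xi1 mul1r.
  (* Doubling allows [D] to replace 2 by f g^- + f^- g, after which the density regroups into
     multiples of [al] and [be]. *)
  rewrite izw /=; apply: (mulfI two0).
  transitivity (Complex eps 0 * (2 * (xi * conjc xi * conjc (g t) * (Psi t).1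
    - conjc xi * g t * (Psi t).2))); first by ring.
  rewrite xi1 mul1r -(D t t0).
  transitivity (Complex eps 0 * ((2 * Complex 0 (h t)) * al t + 2 * Complex (H2 t) 0 * be t)).
    by rewrite half hi hH2 /al /be; ring.
  by rewrite (D t t0); ring.
have abe : cprimitive be (fun t => Complex eps 0 *
    (Complex (H1 t) 0 * al t - Complex 0 (h t) * be t)).
  apply: eq_cprim (cprimZ (conjc xi) (cprim_wronskian hP (csol_wave xi1))) => t t0.
    rewrite /wronskian /be /=.
    transitivity (xi * conjc xi * conjc (f t) * (Psi t).1 - conjc xi * f t * (Psi t).2).
      by ring.
    by rewrite xi1 mul1r.
  rewrite izw /=; apply: (mulfI two0).
  transitivity (Complex eps 0 * (2 * (xi * conjc xi * conjc (f t) * (Psi t).1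
    + conjc xi * f t * (Psi t).2))); first by ring.
  rewrite xi1 mul1r -(D t t0).
  transitivity (Complex eps 0 * (2 * Complex (H1 t) 0 * al t - (2 * Complex 0 (h t)) * be t)).
    by rewrite half hi hH1 /al /be; ring.
  by rewrite (D t t0); ring.
have [ap1 ap2] := aal; have [aq2' aq1] := abe; have aq2 := primN aq2'.
have NE t : 0 <= t -> qform H1 H2 h t (complex.Re (al t)) (complex.Im (be t)) +
    qform H1 H2 h t (complex.Im (al t)) (- complex.Re (be t)) = 2 * cabs2V (Psi t).
  move=> t0.
  have E1 : 2 * (Psi t).1 = al t * f t + be t * g t.
    by rewrite -(D t t0) /al /be; ring.
  have E2 : 2 * (conjc xi * (Psi t).2) = al t * conjc (f t) - be t * conjc (g t).
    by rewrite -(D t t0) /al /be; ring.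
  have c2 : cabs2 (2 : R[i]) = 4 by rewrite /cabs2 /=; ring.
  have cxi : cabs2 (conjc xi) = 1.
    have := congr1 (@complex.Re R) xi1; rewrite cabs2_conjc !ReImE /= => <-.
    by rewrite /cabs2; ring.
  have := congr1 (@cabs2 R) E1; have := congr1 (@cabs2 R) E2.
  rewrite !cabs2M cxi c2 mul1r => C2 C1.
  have : 4 * cabs2V (Psi t) = 2 * (2 * cabs2V (Psi t)) by ring.
  rewrite /cabs2V mulrDr C1 C2 => E.
  have two : (2 : R) != 0 by rewrite pnatr_eq0.
  apply: (mulfI two); rewrite -E.
  by rewrite wave_energyE.
have c1 : conjc (1 : R[i]) = 1 by exact: conjc1.
have al0 : al 0 = a.
  by rewrite /al P0 wave_at0 c1 aE /=; ring.
have be0 : be 0 = b.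
  by rewrite /be P0 wave_at0 c1 bE /=; ring.
have := @energy_comparison _ H1 H2 h cont0_wave_sq cont0_nwave_sq cont0_wave_cross
  wave_sq_gt0 wave_det eps L (fun t => complex.Re (al t)) (fun t => complex.Im (al t))
  (fun t => complex.Im (be t)) (fun t => - complex.Re (be t)) L0 eL.
rewrite al0 be0 => EC; move: EC.
have cst : int0 (fun t => qform H1 H2 h t (complex.Re a) (complex.Im b) +
    qform H1 H2 h t (complex.Im a) (- complex.Re b)) L =
    cabs2 a * int0 H1 L + cabs2 b * int0 H2 L
    + 2 * (complex.Re a * complex.Im b - complex.Im a * complex.Re b) * int0 h L.
  rewrite int0D//; try by apply/cont0_Lint/cont0_qform;
    do ?[exact: cont0_wave_sq|exact: cont0_nwave_sq|exact: cont0_wave_cross|exact: cont0_cst].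
  by rewrite !int0_qform_cst //;
    do ?[exact: cont0_wave_sq|exact: cont0_nwave_sq|exact: cont0_wave_cross]; rewrite /cabs2; ring.
rewrite cst (eq_int0 _ NE) int0Z//; last exact/cont0_Lint/(cont0_cabs2V hP).
have -> : 9 / 4 * (2 * int0 (fun t => cabs2V (Psi t)) L) =
  9 / 2 * int0 (fun t => cabs2V (Psi t)) L by field.
apply.
- apply: eq_prim ap1 => // t _; move: (al t) (be t) (h t) (H1 t) (H2 t).
  by move=> [? ?] [? ?] ? ? ? /=; ring.
- apply: eq_prim aq1 => // t _; move: (al t) (be t) (h t) (H1 t) (H2 t).
  by move=> [? ?] [? ?] ? ? ? /=; ring.
- apply: eq_prim ap2 => // t _; move: (al t) (be t) (h t) (H1 t) (H2 t).
  by move=> [? ?] [? ?] ? ? ? /=; ring.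
- apply: eq_prim aq2 => // t _; move: (al t) (be t) (h t) (H1 t) (H2 t).
  by move=> [? ?] [? ?] ? ? ? /=; ring.
Qed.

End Direction.

End Transfer.

(** * The two-sided bound *)

Section Ratio.
Variables (R : realType) (phi : R -> R[i]) (s : R[i] -> R[i]) (lam : R).
Variables (T1 T2 : R -> R[i] * R[i]).
Hypothesis hs : is_schur phi s.
Hypotheses (hT1 : csol phi (Complex lam 0) T1) (hT2 : csol phi (Complex lam 0) T2).
Hypotheses (T10 : T1 0 = (1, 0)) (T20 : T2 0 = (0, 1)).
Variable xi : R[i].
Hypothesis xi1 : xi * conjc xi = 1.
Implicit Types (x t L e : R).

Local Notation f := (wave T1 T2 xi).
Local Notation g := (wave T1 T2 (- xi)).
Local Notation F := (int0 (wave_sq T1 T2 xi)).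
Local Notation G := (int0 (wave_sq T1 T2 (- xi))).
Local Notation np L := (Num.sqrt (F L)).
Local Notation nm L := (Num.sqrt (G L)).

Let nxi1 : - xi * conjc (- xi) = 1.
Proof. by rewrite conjcN mulrNN. Qed.

Let cf : cont0 (wave_sq T1 T2 xi) := cont0_wave_sq hT1 hT2 T10 T20 xi1.
Let cg : cont0 (wave_sq T1 T2 (- xi)) := cont0_nwave_sq hT1 hT2 T10 T20 xi1.

(** Pointwise |f|^2 |g|^2 >= 1, so |f|^2 + 2 r + r^2 |g|^2 >= 0 for every r; integrate and take the
    discriminant. This yields positivity of both norms and the decay of [eps L]. *)
Lemma sqr_le_FG L : 0 <= L -> L ^+ 2 <= F L * G L.
Proof.
move=> L0; apply: discriminant_le0.
  by apply: int0_ge0 => t _; exact: cabs2_ge0.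
move=> r.
have I1 := cont0_Lint cf; have I2 : Lint (fun=> 2 * r : R) by exact/cont0_Lint/cont0_cst.
have I3 := LintZ (r ^+ 2) (cont0_Lint cg).
have -> : F L + 2 * L * r + G L * r ^+ 2 =
    int0 (fun t => wave_sq T1 T2 xi t + 2 * r + r ^+ 2 * wave_sq T1 T2 (- xi) t) L.
  rewrite (int0D (LintD I1 I2) I3 L0) (int0D I1 I2 L0) (int0Z _ (cont0_Lint cg) L0).
  by rewrite int0_cst//; ring.
apply: int0_ge0 => t t0; have := wave_det hT1 hT2 T10 T20 xi1 t0.
have := wave_sq_gt0 hT1 hT2 T10 T20 xi1 t0.
move: (wave_sq T1 T2 xi t) (wave_sq T1 T2 (- xi) t) (wave_cross _ _ _ _) => a b h a0 ab.
rewrite -(pmulr_rge0 _ a0) (_ : a * (_ + _) = (a + r) ^+ 2 + (a * b - 1) * r ^+ 2); last by ring.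
by rewrite ab addrAC subrr add0r addr_ge0 ?sqr_ge0// mulr_ge0 ?sqr_ge0.
Qed.

Lemma F_gt0 L : 0 < L -> 0 < F L.
Proof.
move=> L0; have := sqr_le_FG (ltW L0).
have : 0 <= F L by apply: int0_ge0 => t _; exact: cabs2_ge0.
rewrite le_eqVlt => /orP[/eqP<-|//]; rewrite mul0r.
by rewrite leNgt exprn_gt0.
Qed.

Lemma G_gt0 L : 0 < L -> 0 < G L.
Proof.
move=> L0; rewrite -(pmulr_rgt0 _ (F_gt0 L0)).
by apply: lt_le_trans (sqr_le_FG (ltW L0)); rewrite exprn_gt0.
Qed.

Lemma np_gt0 L : 0 < L -> 0 < np L. Proof. by move=> /F_gt0; rewrite sqrtr_gt0. Qed.

Lemma nm_gt0 L : 0 < L -> 0 < nm L. Proof. by move=> /G_gt0; rewrite sqrtr_gt0. Qed.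

Local Notation al e := (cabs (s (Complex lam e) + conjc xi)).
Local Notation be e := (cabs (s (Complex lam e) - conjc xi)).
Local Notation eps L := ((2 * np L * nm L)^-1).

Lemma sqr_npnm L : 0 < L -> (np L * nm L) ^+ 2 = F L * G L.
Proof. by move=> L0; rewrite exprMn !sqr_sqrtr// ltW// ?F_gt0 ?G_gt0. Qed.

Lemma le_npnm L : 0 < L -> L <= np L * nm L.
Proof.
move=> L0; have [n0 m0] := (np_gt0 L0, nm_gt0 L0).
rewrite -(ler_pXn2r (n := 2)) ?nnegrE ?(ltW L0) ?(ltW (mulr_gt0 n0 m0))// sqr_npnm//.
exact/sqr_le_FG/ltW.
Qed.

Lemma cabs2_xi : cabs2 xi = 1.
Proof. by have := congr1 (@complex.Re R) xi1; rewrite mulC_conjc. Qed.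

Lemma schur_le1 e : 0 < e -> cabs2 (s (Complex lam e)) <= 1.
Proof.
move=> e0; have [Psi [/is_solP hP P0 P2]] := hs (e0 : 0 < complex.Im (Complex lam e)).
have := weyl_energy hP P2 e0 (lexx 0); rewrite int0_at0 mulr0 P0 /=.
by rewrite (_ : cabs2 1 = 1) ?subr_ge0// /cabs2 /= expr0n addr0 expr1n.
Qed.

Lemma parallelogram e : al e ^+ 2 + be e ^+ 2 = 2 * cabs2 (s (Complex lam e)) + 2.
Proof.
rewrite !cabs_sqr; transitivity (2 * cabs2 (s (Complex lam e)) + 2 * cabs2 xi).
  by rewrite /cabs2 !ReImE; ring.
by rewrite cabs2_xi mulr1.
Qed.

(* [x ^+ 2 + y ^+ 2 <= (2 |Im(a b^-)| - 9/2 Re(a b^-)) ||f|| ||g||], and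
   [2 ^ 2 + (9/2) ^ 2 <= 6 ^ 2]. *)
Lemma coefficient_ratio L : 0 < L -> let x := al (eps L) * np L in
  let y := be (eps L) * nm L in 0 < y /\ x ^+ 2 + y ^+ 2 <= 6 * (x * y).
Proof.
move=> L0 x y; rewrite {}/x {}/y.
have [nF mG] : np L ^+ 2 = F L /\ nm L ^+ 2 = G L.
  by rewrite !sqr_sqrtr ?(ltW (F_gt0 L0)) ?(ltW (G_gt0 L0)).
move: (np_gt0 L0) (nm_gt0 L0) nF mG; move: (np L) (nm L) => n m n0 m0 nF mG.
have e0 : 0 < (2 * n * m)^-1 by rewrite invr_gt0 !mulr_gt0.
have eE : 2 * (2 * n * m)^-1 * (n * m) = 1 by field; rewrite !gt_eqF.
move: e0 eE; move: (_^-1) => e e0 eE.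
have [Psi [/is_solP hP P0 P2]] := hs (e0 : 0 < complex.Im (Complex lam e)).
have := weyl_energy hP P2 e0 (ltW L0); rewrite P0 /=.
rewrite (_ : cabs2 1 = 1); last by rewrite /cabs2 /= expr0n addr0 expr1n.
set M := int0 _ _ => HM.
have eFG : 4 * e ^+ 2 * (F L * G L) <= 1.
  rewrite -nF -mG; have -> : 4 * e ^+ 2 * (n ^+ 2 * m ^+ 2) = (2 * e * (n * m)) ^+ 2 by ring.
  by rewrite eE expr1n.
have := weyl_comparison hT1 hT2 T10 T20 xi1 erefl erefl hP P0 (ltW L0) eFG.
have := int0_h_sqr_le cf cg (cont0_wave_cross hT1 hT2 T10 T20 xi1)
  (wave_sq_gt0 hT1 hT2 T10 T20 xi1) (wave_det hT1 hT2 T10 T20 xi1) (ltW L0).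
rewrite -/M; set S := int0 (wave_cross _ _ _) L; set a := s _ + _; set b := s _ - _.
set I := _ - complex.Im a * _ => HS HC.
(* P and I are minus the real and minus the imaginary part of a b^-, so P^2 + I^2 = |a b|^2. *)
pose P := - (complex.Re a * complex.Re b + complex.Im a * complex.Im b).
have PE : 1 - cabs2 (s (Complex lam e)) = P.
  transitivity (cabs2 xi - cabs2 (s (Complex lam e))); first by rewrite cabs2_xi.
  by rewrite /P /a /b /cabs2 !ReImE; ring.
have aA : al e ^+ 2 = cabs2 a by rewrite cabs_sqr.
have bB : be e ^+ 2 = cabs2 b by rewrite cabs_sqr.
have A0 : 0 <= al e by exact: cabs_ge0.
have B0 : 0 <= be e by exact: cabs_ge0.
have PI : P ^+ 2 + I ^+ 2 = (al e * be e) ^+ 2.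
  by rewrite exprMn aA bB /P /I /cabs2; ring.
rewrite PE in HM.
have ab0 : ~ (al e = 0 /\ be e = 0).
  move=> [a0 b0]; have /eqP := parallelogram e; rewrite a0 b0 expr0n addr0 eq_sym.
  by rewrite gt_eqF// ltr_wpDl// mulr_ge0// cabs2_ge0.
rewrite -nF -mG in HS HC; rewrite -aA -bB in HC.
move: HM HS HC PI A0 B0 ab0; move: (al e) (be e) I P {PE aA bB} => A B I P.
move=> HM HS HC PI A0 B0 ab0.
have nm0 : 0 < n * m by exact: mulr_gt0.
have AB0 : 0 <= A * B by exact: mulr_ge0.
have HM' : M <= P * (n * m).
  have := ler_wpM2r (ltW nm0) HM.
  have -> : 2 * e * M * (n * m) = 2 * e * (n * m) * M by ring.
  by rewrite eE mul1r.
have SI : `|S| <= n * m.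
  by rewrite -(ger0_norm (ltW nm0)) -!sqrtr_sqr ler_wsqrtr// exprMn.
have IS : - (I * S) <= `|I| * (n * m).
  apply: le_trans (ler_norm _) _; rewrite normrN normrM; exact: ler_wpM2l.
have J : 2 * `|I| + 9 / 2 * P <= 6 * (A * B).
  have I2 : `|I| ^+ 2 = I ^+ 2 by rewrite real_normK ?num_real.
  have I0 : 0 <= `|I| by [].
  rewrite leNgt; apply/negP => H.
  have : (6 * (A * B)) ^+ 2 < (2 * `|I| + 9 / 2 * P) ^+ 2.
    by rewrite ltr_sqr ?nnegrE ?mulr_ge0//; apply: le_trans (ltW H); rewrite mulr_ge0.
  rewrite exprMn -PI -I2; have := sqr_ge0 (9 / 2 * `|I| - 2 * P).
  have := sqr_ge0 P; have := sqr_ge0 `|I|; lra.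
have main : (A * n) ^+ 2 + (B * m) ^+ 2 <= 6 * (A * n * (B * m)).
  have := ler_wpM2r (ltW nm0) J; rewrite !exprMn.
  rewrite (_ : 6 * (A * n * (B * m)) = 6 * (A * B) * (n * m)); last by ring.
  lra.
(* If y vanished, [main] would force x = 0 too, hence both coefficients, against [parallelogram]. So
   the quotient a / b is a genuine one, not the default for division by zero. *)
split=> //; rewrite lt_neqAle (mulr_ge0 B0 (ltW m0)) andbT eq_sym.
apply/eqP => Bm; move: main; rewrite Bm mulr0 mulr0 expr0n addr0 => An.
apply: ab0; split; last by move/eqP: Bm; rewrite mulf_eq0 (gt_eqF m0) orbF => /eqP.
have : (A * n) ^+ 2 == 0 by rewrite eq_le An sqr_ge0.
by rewrite sqrf_eq0 mulf_eq0 (gt_eqF n0) orbF => /eqP.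
Qed.

Local Notation r L := (nm L / np L).

Lemma sqrt8_lt3 : Num.sqrt 8 < 3 :> R.
Proof.
rewrite -(ger0_norm (_ : 0 <= 3 :> R))// -sqrtr_sqr ltr_sqrt ?exprn_gt0//.
by rewrite -natrX ltr_nat.
Qed.

(** Completing the square gives (x - 3 y)^2 <= 8 y^2, the origin of 3 +- sqrt 8. *)
Lemma quadratic_window (x y : R) : 0 < y -> x ^+ 2 + y ^+ 2 <= 6 * (x * y) ->
  (3 - Num.sqrt 8) * y <= x <= (3 + Num.sqrt 8) * y.
Proof.
move=> y0 H.
have yE : Num.sqrt 8 * y = Num.sqrt (8 * y ^+ 2) by rewrite sqrtrM// sqrtr_sqr gtr0_norm.
have : `|x - 3 * y| <= Num.sqrt 8 * y by rewrite yE -sqrtr_sqr ler_wsqrtr//; lra.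
by rewrite ler_norml => /andP[lo up]; apply/andP; split; lra.
Qed.

Lemma ratio_bounds L : 0 < L -> 0 < be (eps L) /\
  (3 - Num.sqrt 8) * r L <= al (eps L) / be (eps L) <= (3 + Num.sqrt 8) * r L.
Proof.
move=> L0; have [] := coefficient_ratio L0.
move: (np_gt0 L0) (nm_gt0 L0) (al _) (be _).
move: (np L) (nm L) => n m n0 m0 A B Bm H.
have B0 : 0 < B by move: Bm; rewrite pmulr_lgt0.
have /andP[lo up] := quadratic_window Bm H.
split=> //; apply/andP; split; rewrite mulrA ?ler_pdivlMr ?ler_pdivrMr//.
  by rewrite mulrAC ler_pdivrMr// -mulrA (mulrC m).
by rewrite mulrAC ler_pdivrMr// -mulrA (mulrC m).
Qed.

(** The meeting point of the two halves of the equivalence: it mentions neither [s] nor arbitrary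
    solutions. *)
Definition ratio_infty := forall K, exists2 L0, 0 < L0 & forall L, L0 <= L -> K <= r L.

Lemma cabs2B_le (z w : R[i]) : cabs2 (z - w) <= 2 * cabs2 z + 2 * cabs2 w.
Proof.
rewrite -subr_ge0; have := cabs2_ge0 (z + w); rewrite /cabs2 !ReImE; lra.
Qed.

Lemma coefficient_le2 e : 0 < e -> al e <= 2.
Proof.
move=> e0; have := parallelogram e; have := schur_le1 e0; have := sqr_ge0 (be e).
move: (be e) (cabs2 (s _)) => b c b0 c1 E.
rewrite -(ler_pXn2r (n := 2)) ?nnegrE ?cabs_ge0//; lra.
Qed.

Lemma lim_from_aboveP (w : R[i]) : lim_from_above s lam w <->
  forall eta, 0 < eta -> exists2 d, 0 < d &
    forall e, 0 < e < d -> cabs (s (Complex lam e) - w) < eta.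
Proof.
split=> [/cvgrPdist_lt H eta eta0|H].
  have := H _ eta0; rewrite near_withinE => -[d /= d0 Hd]; exists d => // e /andP[e0 ed].
  have := Hd e; rewrite /= sub0r normrN gtr0_norm// => /(_ ed e0).
  by rewrite sub0r normrN ger0_norm// cabs_ge0.
apply/cvgrPdist_lt => eta eta0; have [d d0 Hd] := H eta eta0.
rewrite near_withinE; exists d => //= e ed e0.
rewrite sub0r normrN ger0_norm ?cabs_ge0//; apply: Hd; rewrite e0/=.
by apply: le_lt_trans ed; rewrite sub0r normrN; exact: ler_norm.
Qed.

Lemma lim_ratio_infty : lim_from_above s lam (conjc xi) -> ratio_infty.
Proof.
move=> /lim_from_aboveP H K.
pose K' := `|K| + 1.
have K0 : 0 < K' by rewrite ltr_wpDl.
(* By [parallelogram], be < 1 forces al >= 1; the second bound then gives al / be >= 6 K', and 3 +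
   sqrt 8 < 6. *)
have [|d d0 Hd] := H (Num.min 1 (6 * K')^-1).
  by rewrite lt_min ltr01 invr_gt0 mulr_gt0.
(* For L >= 1 / d one has [eps L] <= 1 / (2 L) < d. *)
exists d^-1 => [|L dL]; first by rewrite invr_gt0.
have L0 : 0 < L by apply: lt_le_trans dL; rewrite invr_gt0.
have [n0 m0] := (np_gt0 L0, nm_gt0 L0).
have nmL := le_npnm L0.
have e0 : 0 < eps L by rewrite invr_gt0 !mulr_gt0.
have ed : eps L < d.
  rewrite -(invrK d) ltf_pV2 ?posrE ?invr_gt0 ?mulr_gt0//; lra.
have := Hd (eps L); rewrite e0 ed => /(_ isT); rewrite lt_min => /andP[B1 BK].
have [B0 /andP[_ up]] := ratio_bounds L0.
have PE := parallelogram (eps L).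
have r0 : 0 < r L by exact: divr_gt0.
have c0 : 0 <= cabs2 (s (Complex lam (eps L))) by exact: cabs2_ge0.
have A0 : 0 <= al (eps L) by exact: cabs_ge0.
move: PE B1 BK B0 up A0 c0 r0; move: (al _) (be _) (cabs2 _) (r L) => A B c q.
move=> PE B1 BK B0 up A0 c0 q0.
have A1 : 1 <= A.
  rewrite leNgt; apply/negP => A1.
  have : A ^+ 2 < 1 by rewrite expr_lt1.
  have : B ^+ 2 < 1 by rewrite expr_lt1// ltW.
  lra.
have KB : 6 * K' <= A / B.
  rewrite ler_pdivlMr//; apply: le_trans A1; rewrite mulrC.
  by rewrite -ler_pdivlMr ?mul1r ?ltW// mulr_gt0.
have := sqrt8_lt3; have := ler_norm K; rewrite -/K' => KK s8.
have : (3 + Num.sqrt 8) * q <= 6 * q by apply: ler_wpM2r; [exact: ltW|lra].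
rewrite /K' in KB; lra.
Qed.

Lemma cont0_FG : cont0 (fun L => F L * G L).
Proof. by apply: cont0M; apply: int0_cont; exact: cont0_Lint. Qed.

(** The two-sided bound speaks of s only at heights [eps L]; the limit needs all small e. The
    intermediate value theorem is applied to F G, with [sqr_le_FG] giving the upper endpoint. *)
Lemma eps_surj L0 e : 0 < L0 -> 0 < e < eps L0 -> exists2 L, L0 <= L & eps L = e.
Proof.
move=> L00 /andP[e0 eL0].
have [n0 m0] := (np_gt0 L00, nm_gt0 L00).
pose v := (2 * e)^-1; have v0 : 0 < v by rewrite invr_gt0 mulr_gt0.
pose L1 := Num.max L0 v.
have L01 : L0 <= L1 by rewrite le_max lexx.
have L10 : 0 < L1 by exact: lt_le_trans L01.
have lo : F L0 * G L0 <= v ^+ 2.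
  rewrite -sqr_npnm// ler_pXn2r ?nnegrE ?(ltW v0) ?(ltW (mulr_gt0 n0 m0))//.
  move: eL0 n0 m0; move: (np L0) (nm L0) => n m eL0 n0 m0.
  rewrite /v -[X in _ <= X]mul1r ler_pdivlMr ?mulr_gt0//.
  have : e * (2 * n * m) < 1 by rewrite -ltr_pdivlMr ?mulr_gt0// mul1r.
  lra.
have hi : v ^+ 2 <= F L1 * G L1.
  apply: le_trans (sqr_le_FG (ltW L10)).
  by rewrite ler_pXn2r ?nnegrE ?(ltW v0) ?(ltW L10)// le_max lexx orbT.
have cw : {within `[L0, L1], continuous (fun L => F L * G L)}.
  apply: continuous_subspaceW (cont0_FG (ltW L10)) => t /=; rewrite !in_itv/=.
  by move=> /andP[? ->]; rewrite (le_trans (ltW L00)).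
have [|L] := IVT (v := v ^+ 2) L01 cw.
  by rewrite ge_min lo le_max hi orbT.
rewrite in_itv/= => /andP[L0L _] FG; exists L => //.
have Lp : 0 < L by exact: lt_le_trans L0L.
have [n1 m1] := (np_gt0 Lp, nm_gt0 Lp).
have E : np L * nm L = v.
  by apply: (pexpIrn (n := 2)) => //; rewrite ?nnegrE ?sqr_npnm ?ltW// mulr_gt0.
by rewrite -mulrA E /v; field; rewrite gt_eqF.
Qed.

Lemma ratio_infty_lim : ratio_infty -> lim_from_above s lam (conjc xi).
Proof.
move=> H; apply/lim_from_aboveP => eta eta0.
have s8 := sqrt8_lt3.
have c0 : 0 < 3 - Num.sqrt 8 :> R by rewrite subr_gt0.
(* The lower bound turns this into al / be >= 4 / eta; as al <= 2, be <= eta / 2. *)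
have [L0 L00 HL] := H (4 / ((3 - Num.sqrt 8) * eta)).
have [n0 m0] := (np_gt0 L00, nm_gt0 L00).
exists (eps L0) => [|e ee]; first by rewrite invr_gt0 !mulr_gt0.
have [L /[dup] L0L /HL HK eE] := eps_surj L00 ee.
have Lp : 0 < L by exact: lt_le_trans L0L.
have [B0 /andP[lo _]] := ratio_bounds Lp.
rewrite eE in B0 lo; have [e0 _] := andP ee.
have A2 := coefficient_le2 e0; move: (al e) (be e) (r L) A2 B0 lo HK => A B q A2 B0 lo HK.
have : 4 / eta <= A / B.
  apply: le_trans lo; apply: le_trans (ler_wpM2l (ltW c0) HK).
  by rewrite le_eqVlt; apply/orP; left; apply/eqP; field; rewrite !gt_eqF.
rewrite ler_pdivlMr// mulrAC ler_pdivrMr// => H4; have := ler_wpM2r (ltW eta0) A2; lra.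
Qed.

End Ratio.

(** * Subordinacy *)

Section Subordinacy.
Variables (R : realType) (phi : R -> R[i]) (lam : R) (T1 T2 : R -> R[i] * R[i]).
Hypotheses (hT1 : csol phi (Complex lam 0) T1) (hT2 : csol phi (Complex lam 0) T2).
Hypotheses (T10 : T1 0 = (1, 0)) (T20 : T2 0 = (0, 1)).
Implicit Types (U V W : R -> R[i] * R[i]) (xi : R[i]) (x t L : R).

Lemma csol_wave_unique xi V x : xi * conjc xi = 1 -> csol phi (Complex lam 0) V ->
  V 0 = (1, xi) -> 0 <= x -> V x = (wave T1 T2 xi x, xi * conjc (wave T1 T2 xi x)).
Proof.
move=> xi1 hV V0 x0.
have hW := csol_wave hT1 hT2 T10 T20 xi1.
have c1 : conjc (1 : R[i]) = 1 by exact: conjc1.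
rewrite (csol_repr hT1 hT2 hV T10 T20 x0) V0.
by have := csol_repr hT1 hT2 hW T10 T20 x0; rewrite /= (wave_at0 T10 T20) c1 mulr1.
Qed.

Lemma int0_cabs2V_wave xi V : xi * conjc xi = 1 -> csol phi (Complex lam 0) V ->
  V 0 = (1, xi) -> forall L, 0 <= L ->
  int0 (fun t => cabs2V (V t)) L = 2 * int0 (wave_sq T1 T2 xi) L.
Proof.
move=> xi1 hV V0 L L0.
rewrite -int0Z//; last exact/cont0_Lint/(cont0_wave_sq hT1 hT2 T10 T20 xi1).
apply: eq_int0 => t t0; rewrite (csol_wave_unique xi1 hV V0 t0) /cabs2V /=.
by rewrite cabs2M cabs2_conjc (cabs2_xi xi1) mul1r /wave_sq; ring.
Qed.

Variable xi : R[i].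
Hypothesis xi1 : xi * conjc xi = 1.

Let nxi1 : - xi * conjc (- xi) = 1.
Proof. by rewrite conjcN mulrNN. Qed.

Lemma normL2_ratio V W L : 0 < L ->
  csol phi (Complex lam 0) V -> csol phi (Complex lam 0) W ->
  V 0 = (1, - xi) -> W 0 = (1, xi) ->
  normL2 L V / normL2 L W =
  Num.sqrt (int0 (wave_sq T1 T2 (- xi)) L) / Num.sqrt (int0 (wave_sq T1 T2 xi) L).
Proof.
move=> L0 hV hW V0 W0.
rewrite [normL2 L V](_ : _ = Num.sqrt (2 * int0 (wave_sq T1 T2 (- xi)) L)); last first.
  by rewrite -(int0_cabs2V_wave nxi1 hV V0 (ltW L0)).
rewrite [normL2 L W](_ : _ = Num.sqrt (2 * int0 (wave_sq T1 T2 xi) L)); last first.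
  by rewrite -(int0_cabs2V_wave xi1 hW W0 (ltW L0)).
have F0 := np_gt0 hT1 hT2 T10 T20 xi1 L0.
have two : 0 < Num.sqrt 2 :> R by rewrite sqrtr_gt0.
by rewrite !sqrtrM// invfM mulrACA divff ?mul1r// gt_eqF.
Qed.

(** It suffices to test subordinacy on the single competitor with initial data (1, - xi). *)
Lemma subordinate_ratio_infty W : csol phi (Complex lam 0) W -> W 0 = (1, xi) ->
  subordinate phi (Complex lam 0) W -> ratio_infty T1 T2 xi.
Proof.
move=> hW W0 sub K.
have hV := csol_wave hT1 hT2 T10 T20 nxi1.
set V := (fun t => _) in hV.
have V0 : V 0 = (1, - xi).
  have c1 : conjc (1 : R[i]) = 1 by exact: conjc1.
  by rewrite /V (wave_at0 T10 T20) c1 mulr1.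
have /is_solP/sub{}sub := hV.
have /cvgryPge/(_ K) : (fun L => normL2 L V / normL2 L W) @ +oo --> +oo.
  apply: sub => a b H.
  have [] := H 0 (lexx 0); rewrite V0 W0 /= !mulr1 => H1 H2.
  have {H1} bE : b = - a by apply/eqP; rewrite -addr_eq0 addrC H1.
  have xi0 : xi != 0.
    by apply/eqP => x0; move: xi1; rewrite x0 mul0r => /eqP; rewrite eq_sym oner_eq0.
  have : a * xi = 0.
    have two : (2 : R[i]) != 0 by rewrite pnatr_eq0.
    by apply: (mulfI two); rewrite mulr0 -[RHS]oppr0 -H2 bE; ring.
  by move=> /eqP; rewrite mulf_eq0 (negbTE xi0) orbF => /eqP a0; rewrite bE a0 oppr0.
move=> [M [_ HM]]; exists (Num.max M 0 + 1); first by rewrite ltr_wpDl// le_max lexx orbT.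
move=> L ML.
have L0 : 0 < L by apply: lt_le_trans ML; rewrite ltr_wpDl// le_max lexx orbT.
rewrite -(normL2_ratio L0 hV hW V0 W0); apply: HM.
by apply: lt_le_trans ML; rewrite (le_lt_trans (y := Num.max M 0)) ?ltrDl// le_max lexx.
Qed.

(** Every solution satisfies 2 U = d V + e W with V the solution from (1, - xi), and independence of
    U and W means d != 0. So ||U|| inherits the growth of ||V|| relative to ||W||. *)
Lemma ratio_infty_subordinate W : csol phi (Complex lam 0) W -> W 0 = (1, xi) ->
  ratio_infty T1 T2 xi -> subordinate phi (Complex lam 0) W.
Proof.
move=> hW W0 rinf U /is_solP hU indep.
have hV := csol_wave hT1 hT2 T10 T20 nxi1; set V := (fun t => _) in hV.
have V0 : V 0 = (1, - xi).
  have c1 : conjc (1 : R[i]) = 1 by exact: conjc1.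
  by rewrite /V (wave_at0 T10 T20) c1 mulr1.
clearbody V; pose d := (U 0).1 - conjc xi * (U 0).2; pose e := (U 0).1 + conjc xi * (U 0).2.
have dV t : 0 <= t -> d * (V t).1 = 2 * (U t).1 - e * (W t).1 /\
                      d * (V t).2 = 2 * (U t).2 - e * (W t).2.
  move=> t0; have UE := csol_repr hT1 hT2 hU T10 T20 t0.
  have VE := csol_repr hT1 hT2 hV T10 T20 t0.
  have WE := csol_repr hT1 hT2 hW T10 T20 t0.
  move: UE VE WE; rewrite V0 W0 /= => -> -> -> /=.
  have E (p q : R[i]) : d * (1 * p + - xi * q) =
      2 * ((U 0).1 * p + (U 0).2 * q) - e * (1 * p + xi * q).
    rewrite /d /e; transitivity ((U 0).1 * p - conjc xi * (U 0).2 * p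
      - (U 0).1 * xi * q + (xi * conjc xi) * (U 0).2 * q); first by ring.
    rewrite xi1; transitivity (2 * ((U 0).1 * p + 1 * (U 0).2 * q) - (U 0).1 * p
      - (U 0).1 * xi * q - conjc xi * (U 0).2 * p - 1 * (U 0).2 * q); first by ring.
    by rewrite -[in X in _ - X * (U 0).2 * q]xi1; ring.
  by split; exact: E.
have d0 : d != 0.
  apply/eqP => d0; have [] := indep 2 (- e).
    move=> t t0; have [H1 H2] := dV t t0; rewrite !mulNr.
    by rewrite -H1 -H2 d0 !mul0r.
  by move=> /eqP; rewrite pnatr_eq0.
have D0 : 0 < cabs2 d by rewrite -cabs_sqr exprn_gt0// cabs_gt0.
have c4 : cabs2 (2 : R[i]) = 4 by rewrite /cabs2 /=; ring.
have pt t : 0 <= t -> cabs2 d * cabs2V (V t) <= 8 * cabs2V (U t) + 2 * cabs2 e * cabs2V (W t).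
  move=> t0; have [H1 H2] := dV t t0; rewrite /cabs2V mulrDr -!cabs2M H1 H2.
  have := cabs2B_le (2 * (U t).1) (e * (W t).1).
  have := cabs2B_le (2 * (U t).2) (e * (W t).2).
  rewrite !cabs2M c4; lra.
apply/cvgryPge => K.
(* Chosen so that |d|^2 K' absorbs the |e|^2 term of [pt] and leaves 8 K^2. The [+ 1] gives K' >= 1,
   so that K'^2 >= K' and no square root is needed. *)
pose K' := (8 * K ^+ 2 + 2 * cabs2 e) / cabs2 d + 1.
have [L0 L00 HL] := rinf K'.
exists L0; split; first exact: num_real.
move=> L /ltW L0L; have Lp : 0 < L by exact: lt_le_trans L0L.
have {}HL := HL L L0L.
have IV := int0_cabs2V_wave nxi1 hV V0 (ltW Lp).
have IW := int0_cabs2V_wave xi1 hW W0 (ltW Lp).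
have cU := cont0_Lint (cont0_cabs2V hU); have cW := cont0_Lint (cont0_cabs2V hW).
have cV := cont0_Lint (cont0_cabs2V hV).
have : int0 (fun t => cabs2 d * cabs2V (V t)) L <=
    int0 (fun t => 8 * cabs2V (U t) + 2 * cabs2 e * cabs2V (W t)) L.
  apply: le_int0 (ltW Lp) _; [exact: LintZ|by apply: LintD; exact: LintZ|].
  by move=> t /andP[/pt].
rewrite (int0D (LintZ 8 cU) (LintZ (2 * cabs2 e) cW) (ltW Lp)) !int0Z ?(ltW Lp)//.
rewrite IV IW.
have G0 := nm_gt0 hT1 hT2 T10 T20 xi1 Lp; have F0 := np_gt0 hT1 hT2 T10 T20 xi1 Lp.
have FG0 := F_gt0 hT1 hT2 T10 T20 xi1 Lp.
have nF : Num.sqrt (int0 (wave_sq T1 T2 xi) L) ^+ 2 = int0 (wave_sq T1 T2 xi) L.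
  by rewrite sqr_sqrtr// ltW.
have mG : Num.sqrt (int0 (wave_sq T1 T2 (- xi)) L) ^+ 2 = int0 (wave_sq T1 T2 (- xi)) L.
  by rewrite sqr_sqrtr// ltW// -sqrtr_gt0.
set N := int0 (fun t => cabs2V (U t)) L => H.
have -> : normL2 L U / normL2 L W = Num.sqrt (N / (2 * int0 (wave_sq T1 T2 xi) L)).
  rewrite sqrtrM; last by apply: int0_ge0 => t _; rewrite addr_ge0 ?cabs2_ge0.
  by rewrite sqrtrV ?mulr_ge0 ?(ltW FG0)// -IW.
apply: le_trans (ler_norm K) _; rewrite -sqrtr_sqr ler_wsqrtr//.
rewrite ler_pdivlMr ?mulr_gt0//.
move: HL H G0 F0 nF mG.
move: (Num.sqrt (int0 (wave_sq T1 T2 xi) L)) (Num.sqrt (int0 (wave_sq T1 T2 (- xi)) L)) => n m.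
move=> HL H G0 F0 nF mG; rewrite -nF; rewrite -nF -mG in H.
move: HL; rewrite ler_pdivlMr// => HL.
have K1 : 1 <= K'.
  by rewrite lerDr divr_ge0 ?(ltW D0)// addr_ge0// mulr_ge0 ?sqr_ge0 ?cabs2_ge0.
have dK : cabs2 d * K' = 8 * K ^+ 2 + 2 * cabs2 e + cabs2 d.
  by rewrite /K'; field; rewrite gt_eqF.
have m2 : K' * n ^+ 2 <= m ^+ 2.
  have K0 : 0 <= K' by exact: le_trans K1.
  apply: (@le_trans _ _ ((K' * n) ^+ 2)); last first.
    by rewrite ler_pXn2r ?nnegrE ?mulr_ge0 ?(ltW G0) ?(ltW F0).
  by rewrite exprMn ler_wpM2r ?sqr_ge0// expr2 ler_peMl.
have := ler_wpM2l (ltW D0) m2; rewrite mulrA dK => Hm.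
have := mulr_ge0 (ltW D0) (sqr_ge0 n).
lra.
Qed.


End Subordinacy.

Theorem theorem3p1 (R : realType) (phi : R -> R[i]) (s : R[i] -> R[i]) (lam : R)
    (T1 T2 : R -> R[i] * R[i]) :
  unif_loc_L1 phi ->
  is_schur phi s ->
  is_sol phi (lam%:C)%C T1 -> T1 0 = (1, 0) ->
  is_sol phi (lam%:C)%C T2 -> T2 0 = (0, 1) ->
  let A := fun x => (T1 x).1 in
  let B := fun x => (T2 x).1 in
  let c_minus := 3 - Num.sqrt 8 : R in
  let c_plus := 3 + Num.sqrt 8 : R in
  (forall xi : R[i], cabs xi = 1 -> forall L : R, 0 < L ->
     let np := normL L (fun x => A x + xi * B x) in
     let nm := normL L (fun x => A x - xi * B x) in
     let eps := (2 * np * nm)^-1 in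
     let q := cabs ((1 + xi * s (Complex lam eps)) / (1 - xi * s (Complex lam eps))) in
     c_minus * (nm / np) <= q <= c_plus * (nm / np))
  /\
  (forall xi : R[i], cabs xi = 1 ->
     forall W : R -> R[i] * R[i], is_sol phi (lam%:C)%C W -> W 0 = (1, xi) ->
       (lim_from_above s lam (conjc xi) <-> subordinate phi (lam%:C)%C W)).
Proof.
move=> _ hs /is_solP hT1 T10 /is_solP hT2 T20 A B c_minus c_plus.
have unimodular (xi : R[i]) : cabs xi = 1 -> xi * conjc xi = 1.
  by move=> xi1; rewrite mulC_conjc -cabs_sqr xi1 expr1n.
split=> xi cxi.
- have xi1 := unimodular xi cxi; move=> L L0; cbv zeta.
  set np := normL L (fun x => A x + xi * B x).
  set nm := normL L (fun x => A x - xi * B x).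
  set eps := _^-1; set q := cabs _.
  have npE : np = Num.sqrt (int0 (wave_sq T1 T2 xi) L) by [].
  have nmE : nm = Num.sqrt (int0 (wave_sq T1 T2 (- xi)) L).
    by rewrite /nm (_ : (fun x => _) = wave T1 T2 (- xi))//; apply/funext => x;
      rewrite /wave mulNr.
  have [] := ratio_bounds hs hT1 hT2 T10 T20 xi1 L0; rewrite -npE -nmE -/eps => B0.
  set a := s _ + _; set b := s _ - _ in B0 *.
  (* Needed to split the modulus of the quotient; the two sides of it are xi a and - xi b because xi
     xi^- = 1. *)
  have b0 : b != 0 by apply: contraTneq B0 => ->; rewrite cabs0 ltxx.
  have xi0 : xi != 0.
    by apply/eqP => x0; move: cxi; rewrite x0 cabs0 => /eqP; rewrite eq_sym oner_eq0.
  have -> : cabs a / cabs b = q; last by [].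
  rewrite /q (_ : 1 + _ = xi * a); last by rewrite /a mulrDr xi1 addrC.
  rewrite (_ : 1 - _ = - (xi * b)); last by rewrite /b mulrBr xi1 opprB.
  rewrite cabs_div ?oppr_eq0 ?mulf_neq0// cabsN !cabsM cxi !mul1r//.
- have xi1 := unimodular xi cxi; move=> W /is_solP hW W0; split.
    move/(lim_ratio_infty hs hT1 hT2 T10 T20 xi1).
    exact: (ratio_infty_subordinate hT1 hT2 T10 T20 xi1 hW W0).
  move/(subordinate_ratio_infty hT1 hT2 T10 T20 xi1 hW W0).
  exact: (ratio_infty_lim hs hT1 hT2 T10 T20 xi1).
Qed.
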